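(* Let $k\in\mathbb{Z}^+$, $1<p<\infty$, let $X_i$ be a real Banach space for every $i\in\mathbb{N}$ and let $X=(\oplus_pX_i)_{i\in\mathbb{N}}$. Then the following statements are equivalent. (1) $X$ is $k$-WUR (respectively, $k$-WLUR, $k$-WMLUR). (2) There exists $j\in\mathbb{N}$ such that $X_i$ is WUR (respectively, WLUR, WMLUR) for all $i>j$, and for each $i\le j$ there exists $k_i\in\mathbb{Z}^+$, with $\sum_{i=1}^{j}k_i-j+1\le k$, such that $X_i$ is $k_i$-WUR (respectively, $k_i$-WLUR, $k_i$-WMLUR).
   Context: $(\oplus_pX_i)_{i\in\mathbb{N}}$ is the $\ell_p$-product: sequences $(x_i)$ with $x_i\in X_i$ and $\|(x_i)\|=(\sum_i\|x_i\|^p)^{1/p}<\infty$. The claim comprises three separate equivalences, one for each notion. For a Banach space $Z$ with unit sphere $S_Z$ and dual $Z^*$, $z_1,\dots,z_{k+1}\in Z$ and $f_1,\dots,f_k\in Z^*$, $D_k[(z_i)_{i=1}^{k+1};(f_j)_{j=1}^{k}]$ denotes the determinant of the $(k+1)\times(k+1)$ matrix whose first row consists of ones and whose $(j+1,i)$ entry is $f_j(z_i)$. For $k\in\mathbb{Z}^+$: $Z$ is $k$-WUR ($k$-weakly uniformly rotund) if for every $\epsilon>0$ and $f_1,\dots,f_k\in S_{Z^*}$, $$\inf\Big(\{1\}\cup\Big\{1-\tfrac{1}{k+1}\Big\|\sum_{i=1}^{k+1}z_i\Big\| : z_1,\dots,z_{k+1}\in S_Z,\ |D_k[(z_i)_{i=1}^{k+1};(f_j)_{j=1}^{k}]|\ge\epsilon\Big\}\Big)>0.$$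 $Z$ is $k$-WLUR ($k$-weakly locally uniformly rotund) if for every $z\in S_Z$, $\epsilon>0$ and $f_1,\dots,f_k\in S_{Z^*}$, $$\inf\Big(\{1\}\cup\Big\{1-\tfrac{1}{k+1}\Big\|z+\sum_{i=1}^{k}z_i\Big\| : z_1,\dots,z_{k}\in S_Z,\ |D_k[z,(z_i)_{i=1}^{k};(f_j)_{j=1}^{k}]|\ge\epsilon\Big\}\Big)>0.$$ $Z$ is $k$-WMLUR ($k$-weakly midpoint locally uniformly rotund) if for any $z\in S_Z$ and any sequences $(z_n^{(1)}),\dots,(z_n^{(k+1)})$ in $S_Z$ with $\|(k+1)z-\sum_{i=1}^{k+1}z_n^{(i)}\|\to0$, it follows that $D_k[(z_n^{(i)})_{i=1}^{k+1};(f_j)_{j=1}^{k}]\to0$ for all $f_1,\dots,f_k\in S_{Z^*}$. WUR, WLUR, WMLUR mean $1$-WUR, $1$-WLUR, $1$-WMLUR. *)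

(* Defs.v *)
From HB Require Import structures.
From mathcomp Require Import all_boot all_order all_algebra.
From mathcomp Require Import all_classical all_reals all_analysis.

Set Implicit Arguments.
Unset Strict Implicit.
Unset Printing Implicit Defensive.

Import Order.TTheory GRing.Theory Num.Theory.
Import numFieldNormedType.Exports.

Local Open Scope classical_set_scope.
Local Open Scope ring_scope.

Section lp_product.
Context {R : realType} (X : nat -> completeNormedModType R).

(* The p-th power of the norm of x, as an extended real. *)
Definition lp_sum (p : R) (x : forall i, X i) : \bar R :=
  (\sum_(i <oo) (`|x i| `^ p)%:E)%E.

Record lp_product (p : R) (p1 : 1 <= p) := LpProduct {
  lp_coord :> forall i, X i;
  lp_sum_fin : (lp_sum p lp_coord < +oo)%E }.

End lp_product.

Section lp_module.
Context {R : realType} {X : nat -> completeNormedModType R} {p : R}.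
Context (p1 : 1 <= p).

Local Notation Xp := (lp_product X p1).

HB.instance Definition _ := gen_eqMixin Xp.
HB.instance Definition _ := gen_choiceMixin Xp.

Let p0 : 0 < p. Proof. exact: lt_le_trans p1. Qed.

Lemma lp_productP (x y : Xp) : (forall i, x i = y i) -> x = y.
Proof.
case: x y => [x hx] [y hy] /= xy.
have exy : x = y by apply: functional_extensionality_dep.
by subst y; congr LpProduct; exact: Prop_irrelevance.
Qed.

Lemma lp_sum_ge0 (x : forall i, X i) : (0 <= lp_sum p x)%E.
Proof. by apply: nneseries_ge0 => n _ _; rewrite lee_fin powR_ge0. Qed.

Lemma lp_sumLnorm (x : forall i, X i) :
  (lp_sum p x `^ p^-1 = 'N[counting]_p%:E[EFin \o (fun i => `|x i|)%R])%E.
Proof.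
rewrite Lnorm_counting//; congr (_ `^ _)%E; apply: eq_eseriesr => i _ /=.
by rewrite normr_id.
Qed.

Lemma lp_sum_ub (x : forall i, X i) (M : \bar R) :
  (forall n, (\sum_(i < n) `|x i| `^ p)%:E <= M)%E -> (lp_sum p x <= M)%E.
Proof.
move=> xM; apply: lime_le.
  by apply: is_cvg_nneseries => n _ _; rewrite lee_fin powR_ge0.
by apply: nearW => n; rewrite sumEFin big_mkord.
Qed.

Lemma lp_sum_lb (x : forall i, X i) n :
  ((\sum_(i < n) `|x i| `^ p)%:E <= lp_sum p x)%E.
Proof.
rewrite -sumEFin -(big_mkord xpredT (fun i => (`|x i| `^ p)%:E)).
by apply: nneseries_lim_ge => i _ _; rewrite lee_fin powR_ge0.
Qed.

Lemma lp_minkowski (x y : forall i, X i) :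
  (lp_sum p (fun i => x i + y i)%R `^ p^-1 <=
   lp_sum p x `^ p^-1 + lp_sum p y `^ p^-1)%E.
Proof.
rewrite (lp_sumLnorm x) (lp_sumLnorm y).
apply: le_trans (minkowski_EFin _ _ _ p1) => //.
rewrite Lnorm_counting//; apply: gt0_ler_poweR.
- by rewrite invr_ge0 ltW.
- by rewrite in_itv/= leey andbT; apply: lp_sum_ge0.
- rewrite in_itv/= leey andbT.
  by apply: nneseries_ge0 => n _ _; rewrite lee_fin powR_ge0.
- apply: lee_nneseries => [i _ _|i _]; first by rewrite lee_fin powR_ge0.
  rewrite lee_fin; apply: ge0_ler_powR; rewrite ?nnegrE ?(ltW p0)//.
  by rewrite (le_trans (ler_normD _ _))// ler_norm.
Qed.

Lemma lp_fin0 : (lp_sum p (fun i => 0%R : X i) < +oo)%E.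
Proof.
rewrite /lp_sum eseries0// => i _ _.
by rewrite normr0 powR0// gt_eqF.
Qed.

Lemma lp_finD (x y : Xp) : (lp_sum p (fun i => x i + y i)%R < +oo)%E.
Proof.
have := lp_minkowski x y.
rewrite ltNge leye_eq; apply: contraTN => /eqP ->.
rewrite poweRyr ?invr_neq0 ?gt_eqF// -ltNge lte_add_pinfty// poweR_lty//;
  exact: lp_sum_fin.
Qed.

Lemma lp_sumZ (a : R) (x : forall i, X i) :
  (lp_sum p (fun i => a *: x i)%R = (`|a| `^ p)%:E * lp_sum p x)%E.
Proof.
rewrite /lp_sum -nneseriesZl; last by move=> i _; rewrite lee_fin powR_ge0.
by apply: eq_eseriesr => i _; rewrite normrZ powRM// EFinM.
Qed.

Lemma lp_finZ (a : R) (x : Xp) : (lp_sum p (fun i => a *: x i)%R < +oo)%E.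
Proof.
rewrite lp_sumZ lte_mul_pinfty// ?lee_fin ?powR_ge0//; exact: lp_sum_fin.
Qed.

Lemma lp_finN (x : Xp) : (lp_sum p (fun i => - x i)%R < +oo)%E.
Proof.
have -> : (fun i => - x i) = (fun i => -1 *: x i).
  by apply: functional_extensionality_dep => i; rewrite scaleN1r.
exact: (lp_finZ (-1) x).
Qed.

Definition lp_zero : Xp := LpProduct p1 lp_fin0.
Definition lp_opp (x : Xp) : Xp := LpProduct p1 (lp_finN x).
Definition lp_add (x y : Xp) : Xp := LpProduct p1 (lp_finD x y).
Definition lp_scale (a : R) (x : Xp) : Xp := LpProduct p1 (lp_finZ a x).

Let lp_addA : associative lp_add.
Proof. by move=> x y z; apply: lp_productP => i /=; rewrite addrA. Qed.
Let lp_addC : commutative lp_add.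
Proof. by move=> x y; apply: lp_productP => i /=; rewrite addrC. Qed.
Let lp_add0 : left_id lp_zero lp_add.
Proof. by move=> x; apply: lp_productP => i /=; rewrite add0r. Qed.
Let lp_addN : left_inverse lp_zero lp_opp lp_add.
Proof. by move=> x; apply: lp_productP => i /=; rewrite addNr. Qed.

HB.instance Definition _ :=
  GRing.isZmodule.Build Xp lp_addA lp_addC lp_add0 lp_addN.

Let lp_scaleA a b (x : Xp) : lp_scale a (lp_scale b x) = lp_scale (a * b) x.
Proof. by apply: lp_productP => i /=; rewrite scalerA. Qed.
Let lp_scale1 : left_id 1 lp_scale.
Proof. by move=> x; apply: lp_productP => i /=; rewrite scale1r. Qed.
Let lp_scaleDr : right_distributive lp_scale +%R.
Proof. by move=> a x y; apply: lp_productP => i /=; rewrite scalerDr. Qed.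
Let lp_scaleDl (x : Xp) : {morph lp_scale^~ x : a b / a + b}.
Proof. by move=> a b; apply: lp_productP => i /=; rewrite scalerDl. Qed.

HB.instance Definition _ := GRing.Zmodule_isLmodule.Build R Xp
  lp_scaleA lp_scale1 lp_scaleDr lp_scaleDl.

Definition lp_norm (x : Xp) : R := fine (lp_sum p x) `^ p^-1.

Lemma lp_normE (x : Xp) : ((lp_norm x)%:E = lp_sum p x `^ p^-1)%E.
Proof.
by rewrite -poweR_EFin fineK// ge0_fin_numE ?lp_sum_ge0//; exact: lp_sum_fin.
Qed.

Let lp_normD (x y : Xp) : lp_norm (x + y) <= lp_norm x + lp_norm y.
Proof.
rewrite -lee_fin EFinD [leLHS]lp_normE [X in (_ <= X + _)%E]lp_normE.
by rewrite [X in (_ <= _ + X)%E]lp_normE; apply: lp_minkowski.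
Qed.

Let lp_normZ (a : R) (x : Xp) : lp_norm (a *: x) = `|a| * lp_norm x.
Proof.
apply: EFin_inj; rewrite EFinM [LHS]lp_normE [X in (_ = _ * X)%E]lp_normE.
rewrite [X in (X `^ _)%E]lp_sumZ poweRM ?lp_sum_ge0//.
by rewrite poweR_EFin -powRrM divff ?gt_eqF// powRr1.
Qed.

Let lp_norm0_eq0 (x : Xp) : lp_norm x = 0 -> x = 0.
Proof.
move=> /powR_eq0_eq0 x0; apply: lp_productP => i.
have := lp_sum_lb x i.+1; rewrite -(@fineK _ (lp_sum p x)); last first.
  by rewrite ge0_fin_numE ?lp_sum_ge0//; exact: lp_sum_fin.
rewrite x0 lee_fin big_ord_recr/= => le0.
have : `|x i| `^ p <= 0.
  by apply: le_trans le0; rewrite lerDr sumr_ge0// => j _; rewrite powR_ge0.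
rewrite le_eqVlt ltNge powR_ge0 orbF => /eqP/powR_eq0_eq0.
by move/eqP; rewrite normr_eq0 => /eqP.
Qed.

HB.instance Definition _ := Lmodule_isNormed.Build R Xp
  lp_normD lp_normZ lp_norm0_eq0.

Lemma lp_normrE (x : Xp) : `|x| = lp_norm x.
Proof. by []. Qed.

Lemma lp_coord_le_norm (x : Xp) i : `|x i| <= `|x|.
Proof.
rewrite lp_normrE -[leLHS]powRr1// -(divff (lt0r_neq0 p0)) powRrM.
apply: ge0_ler_powR; rewrite ?nnegrE ?invr_ge0 ?powR_ge0 ?(ltW p0)//.
  exact/fine_ge0/lp_sum_ge0.
rewrite -lee_fin fineK; last first.
  by rewrite ge0_fin_numE ?lp_sum_ge0//; exact: lp_sum_fin.
apply: le_trans (lp_sum_lb x i.+1); rewrite lee_fin big_ord_recr/=.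
by rewrite lerDr sumr_ge0// => j _; rewrite powR_ge0.
Qed.

Lemma lp_norm_sum_le (x : Xp) n e :
  `|x| <= e -> \sum_(i < n) `|x i| `^ p <= e `^ p.
Proof.
move=> xe; have e0 : 0 <= e by apply: le_trans xe.
rewrite -lee_fin; apply: le_trans (lp_sum_lb x n) _.
have -> : lp_sum p x = (`|x| `^ p)%:E.
  rewrite lp_normrE /lp_norm -powRrM mulVf ?gt_eqF// powRr1.
    rewrite fineK// ge0_fin_numE ?lp_sum_ge0//; exact: lp_sum_fin.
  exact/fine_ge0/lp_sum_ge0.
by rewrite lee_fin; apply: ge0_ler_powR; rewrite ?nnegrE// ltW.
Qed.

Lemma cvg_powR_ge0 (T : Type) (F : set_system T) (FF : Filter F) (u : T -> R)
    (a : R) : (forall t, 0 <= u t) -> 0 <= a ->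
  u t @[t --> F] --> a -> u t `^ p @[t --> F] --> a `^ p.
Proof.
move=> u0; rewrite le_eqVlt => /predU1P[<-|a0] ua.
  rewrite powR0 ?gt_eqF//.
  apply: (@squeeze_cvgr _ _ _ _ (fun=> 0) u) => //; last exact: cvg_cst.
  near=> t; rewrite powR_ge0/=.
  have [->|ut0] := eqVneq (u t) 0; first by rewrite powR0 ?gt_eqF.
  apply: ge1r_powR => //; rewrite lt_neqAle eq_sym ut0 u0/=.
  by near: t; apply: (cvgr_le _ ua).
apply: (@continuous_cvg T R R F FF u (fun x : R => x `^ p) a) => //.
apply: (@differentiable_continuous _ R^o R^o).
apply/derivable1_diffP; apply: derivable_powR.
by rewrite in_itv/= a0.
Unshelve. all: by end_near. Qed.

Lemma lp_complete (F : set_system Xp) : ProperFilter F -> cauchy F -> cvg F.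
Proof.
move=> FF /cauchy_ballP Fc.
have Fi i : cvg ((fun x : Xp => x i) @ F).
  apply: cauchy_cvg; apply/cauchy_ballP => e e0; rewrite near_map2.
  apply: filterS (Fc e e0) => -[x y] /=; rewrite -!ball_normE/=.
  exact/le_lt_trans/(lp_coord_le_norm (x - y)).
pose l i : X i := lim ((fun x : Xp => x i) @ F).
have key (e : R) : 0 < e ->
    \forall x \near F,
      forall n, \sum_(i < n) `|(x : Xp) i - l i| `^ p <= e `^ p.
  move=> e0; have [[A B] [/= FA FB] AB] := Fc e e0.
  near=> x => n.
  have cv : \sum_(i < n) `|x i - (y : Xp) i| `^ p @[y --> F] -->
            \sum_(i < n) `|x i - l i| `^ p.
    apply: cvg_big => [|i _]; first exact: add_continuous.
    apply: cvg_powR_ge0 => //.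
    by apply: cvg_norm; apply: cvgB; [exact: cvg_cst|exact: Fi].
  apply: (cvgr_to_le cv); near=> y.
  have := AB (x, y); rewrite /= -ball_normE/= => xy.
  apply: (@lp_norm_sum_le (x - y)); apply/ltW/xy; split; last by near: y.
  by near: x.
have lfin : (lp_sum p l < +oo)%E.
  have [x xl] := filter_ex (key 1 ltr01).
  have xlfin : (lp_sum p (fun i => x i - l i)%R < +oo)%E.
    apply: le_lt_trans (ltry (1 `^ p)); apply: lp_sum_ub => n.
    by rewrite lee_fin.
  have := lp_finD x (lp_opp (LpProduct p1 xlfin)).
  congr (_ < _)%E; congr lp_sum; apply: functional_extensionality_dep => i /=.
  by rewrite opprB addrC subrK.
apply/cvg_ex; exists (LpProduct p1 lfin).
apply/cvgrPdist_le => e e0; apply: filterS (key e e0) => x xl.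
rewrite distrC lp_normrE -lee_fin lp_normE.
have -> : e = (e `^ p) `^ p^-1.
  by rewrite -powRrM divff ?gt_eqF// powRr1// ltW.
rewrite -poweR_EFin; apply: gt0_ler_poweR.
- by rewrite invr_ge0 ltW.
- by rewrite in_itv/= leey andbT; apply: lp_sum_ge0.
- by rewrite in_itv/= leey andbT lee_fin powR_ge0.
- by apply: lp_sum_ub => n; rewrite lee_fin; exact: xl.
Unshelve. all: by end_near. Qed.

HB.instance Definition _ := Uniform_isComplete.Build Xp lp_complete.

End lp_module.

Section rotundity.
Context {R : realType}.
Implicit Type Z : normedModType R.

Definition usphere Z : set Z := [set z | `|z| = 1].

(* Operator norm of a continuous linear functional; a real supremum, hence
   meaningful only for bounded f, which dual_usphere enforces by continuity. *)
Definition dual_norm Z (f : Z -> R) : R :=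
  sup [set `|f z| | z in [set z : Z | `|z| <= 1]].

Definition dual_usphere Z : set {linear Z -> R^o} :=
  [set f : {linear Z -> R^o} |
    continuous (f : Z -> R^o) /\ dual_norm (f : Z -> R) = 1].

Definition rotund_mx Z k (z : 'I_k.+1 -> Z) (f : 'I_k -> {linear Z -> R^o}) :
    'M[R]_k.+1 :=
  \matrix_(j, i) if unlift ord0 j is Some j' then f j' (z i) else 1.

Definition rotund_det Z k (z : 'I_k.+1 -> Z)
    (f : 'I_k -> {linear Z -> R^o}) : R := \det (rotund_mx z f).

(* The infima in kWUR and kWLUR are over nonempty sets bounded below by 0, so
   the real-valued inf is the genuine infimum. *)
Definition kWUR (k : nat) Z : Prop :=
  forall (e : R) (f : 'I_k -> {linear Z -> R^o}),
    0 < e -> (forall j, dual_usphere (f j)) ->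
    0 < inf ([set 1] `|`
      [set 1 - k.+1%:R^-1 * `|\sum_i z i| | z in
        [set z : 'I_k.+1 -> Z |
          (forall i, usphere (z i)) /\ e <= `|rotund_det z f| ]]).

Definition cons_fam Z k (z : Z) (zs : 'I_k -> Z) : 'I_k.+1 -> Z :=
  fun i => if unlift ord0 i is Some i' then zs i' else z.

Definition kWLUR (k : nat) Z : Prop :=
  forall (z : Z) (e : R) (f : 'I_k -> {linear Z -> R^o}),
    usphere z -> 0 < e -> (forall j, dual_usphere (f j)) ->
    0 < inf ([set 1] `|`
      [set 1 - k.+1%:R^-1 * `|z + \sum_i zs i| | zs in
        [set zs : 'I_k -> Z |
          (forall i, usphere (zs i)) /\
          e <= `|rotund_det (cons_fam z zs) f| ]]).

Definition kWMLUR (k : nat) Z : Prop :=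
  forall (z : Z) (zs : 'I_k.+1 -> nat -> Z),
    usphere z -> (forall i n, usphere (zs i n)) ->
    `|k.+1%:R *: z - \sum_i zs i n| @[n --> \oo] --> (0 : R) ->
    forall f : 'I_k -> {linear Z -> R^o}, (forall j, dual_usphere (f j)) ->
      rotund_det (zs^~ n) f @[n --> \oo] --> (0 : R).

Definition WUR := kWUR 1.
Definition WLUR := kWLUR 1.
Definition WMLUR := kWMLUR 1.

End rotundity.

(* Main.v *)
From HB Require Import structures.
Require Import Defs.
From mathcomp Require Import all_boot all_order all_algebra.
From mathcomp Require Import all_classical all_reals all_analysis.
From mathcomp Require Import ring lra.

(* Idea. Along a nonprincipal ultrafilter U, each of the three notions fails
   for k exactly when there are a bounded base sequence z and k bounded
   sequences v_i along which the norm is asymptotically flat at z (with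
   nonnegative coefficients for WUR and WLUR, arbitrary signs for WMLUR; z
   constant for WLUR and WMLUR), the matrix (lim_U f_j(v_i)) being invertible
   for some functionals f_j. So k-rotundity says that the "flat rank" is less
   than k. In an l_p-product, strict convexity of t |-> t^p shows that the
   coordinates of a flat family are flat, and f(x) = \sum_l f_l(x_l) uniformly
   on bounded sets because p > 1, so the limit matrix is the sum of those of the
   coordinates; conversely, flat families of distinct coordinates combine into
   a block triangular one. Hence the flat rank is additive. *)

Set Implicit Arguments.
Unset Strict Implicit.
Unset Printing Implicit Defensive.

Import Order.TTheory GRing.Theory Num.Theory.
Import numFieldNormedType.Exports.
Local Open Scope classical_set_scope.
Local Open Scope ring_scope.

(** * Flat families along an ultrafilter *)

(** D_k compares affine positions and is bounded below only by a threshold, so it does not split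
    over the coordinates of the product. In the limit along U the threshold becomes the
    invertibility of one matrix, and rank does split: it is subadditive on sums of matrices, and a
    block triangular matrix with invertible diagonal blocks is invertible. The two facts give the
    two directions of the theorem. The index bound is this additivity shifted by one: each X_i may
    contribute a rank of at most k_i - 1, and the sum of these numbers must stay at most k - 1. A
    single ultrafilter makes all limits exist at once, for every coordinate, vector and functional,
    with no subsequences to be reconciled between infinitely many coordinates. *)

Lemma mxsub_det_neq0 (F : fieldType) m n r (A : 'M[F]_(m, n)) :
  (r <= \rank A)%N ->
  exists (h : 'I_r -> 'I_m) (g : 'I_r -> 'I_n), \det (mxsub h g A) != 0.
Proof.
move=> rA.
(* Independent rows are chosen first and cut down to r of them; the columns are then chosen in the
   same way after transposition. *)
pose B := rowsub (maxrankfun A) A.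
have freeB : row_free B by exact: maxrowsub_free.
pose h (i : 'I_r) : 'I_m := maxrankfun A (widen_ord rA i).
have freeC : row_free (rowsub h A).
  have -> : rowsub h A = rowsub (widen_ord rA) B.
    by apply/matrixP => i j; rewrite !mxE.
  apply/row_freeP; have /row_freeP[D BD] := freeB.
  exists (colsub (widen_ord rA) D).
  rewrite mulmx_colsub mul_rowsub_mx BD.
  by apply/matrixP => i j; rewrite !mxE -val_eqE.
have fullT : row_full (rowsub h A)^T by rewrite /row_full mxrank_tr.
exists h, (fullrankfun fullT).
have : row_full (rowsub (fullrankfun fullT) (rowsub h A)^T).
  exact: fullrowsub_full.
rewrite row_full_unit unitmxE unitfE -det_tr; congr (\det _ != 0).
by apply/matrixP => i j; rewrite !mxE.
Qed.

Lemma det_eq0P (F : fieldType) n (A : 'M[F]_n) :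
  reflect (exists2 c : 'I_n -> F, (exists i, c i != 0) &
             forall j, \sum_i c i * A j i = 0) (\det A == 0).
Proof.
rewrite -det_tr; apply: (iffP det0P) => -[c c0 cA].
  exists (fun i => c 0 i).
    apply/existsP; apply: contra_neqT c0 => /existsPn c0.
    by apply/rowP => i; rewrite mxE; apply/eqP; have := c0 i; rewrite negbK.
  move=> j; move/rowP/(_ j) : cA; rewrite !mxE => cA.
  by rewrite -[RHS]cA; apply: eq_bigr => i _; rewrite mxE.
exists (\row_i c i).
  by have [i] := c0; apply: contra_neq => /rowP/(_ i); rewrite !mxE.
apply/rowP => j; rewrite !mxE -[RHS](cA j).
by apply: eq_bigr => i _; rewrite !mxE.
Qed.

(** * Bounded sequences and continuous functionals *)

Section bounded_seq.
Context {R : realType}.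
Implicit Type Z : normedModType R.

Definition bounded_seq Z (z : nat -> Z) := exists M : R, forall n, `|z n| <= M.

Lemma bounded_seq_cst Z (a : Z) : bounded_seq (fun=> a).
Proof. by exists `|a|. Qed.

Lemma bounded_seqD Z (y z : nat -> Z) :
  bounded_seq y -> bounded_seq z -> bounded_seq (fun n => y n + z n).
Proof.
move=> [M yM] [N zN]; exists (M + N) => n.
by rewrite (le_trans (ler_normD _ _))// lerD.
Qed.

Lemma bounded_seqZ Z (a : R) (z : nat -> Z) :
  bounded_seq z -> bounded_seq (fun n => a *: z n).
Proof. by move=> [M zM]; exists (`|a| * M) => n; rewrite normrZ ler_wpM2l. Qed.

Lemma bounded_seqB Z (y z : nat -> Z) :
  bounded_seq y -> bounded_seq z -> bounded_seq (fun n => y n - z n).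
Proof.
move=> [M yM] [N zN]; exists (M + N) => n.
by rewrite (le_trans (ler_normB _ _))// lerD.
Qed.

Lemma bounded_seq_sum Z (I : finType) (z : I -> nat -> Z) :
  (forall i, bounded_seq (z i)) -> bounded_seq (fun n => \sum_i z i n).
Proof.
move=> /choice[M zM]; exists (\sum_i M i) => n.
by rewrite (le_trans (ler_norm_sum _ _ _))// ler_sum.
Qed.

Lemma bounded_seq_lincomb Z (I : finType) (t : I -> R) z (v : I -> nat -> Z) :
  bounded_seq z -> (forall i, bounded_seq (v i)) ->
  bounded_seq (fun n => z n + \sum_i t i *: v i n).
Proof.
move=> zb vb; apply: bounded_seqD zb _; apply: bounded_seq_sum => i.
exact: bounded_seqZ.
Qed.

Lemma bounded_seq_norm Z (z : nat -> Z) :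
  bounded_seq z -> bounded_seq (fun n => `|z n|).
Proof. by move=> [M zM]; exists M => n; rewrite normr_id. Qed.

Lemma continuous_linear_norm_le Z (f : {linear Z -> R^o}) :
  continuous (f : Z -> R^o) -> exists2 K : R, 0 < K & forall x, `|f x| <= K * `|x|.
Proof.
move=> /(_ 0)/continuous_linear_bounded/linear_boundedP/pinfty_ex_gt0[K K0 fK].
by exists K.
Qed.

Lemma linear_norm_le_continuous Z (f : {linear Z -> R^o}) (K : R) :
  (forall x, `|f x| <= K * `|x|) -> continuous (f : Z -> R^o).
Proof.
move=> fK; apply: bounded_linear_continuous; apply/linear_boundedP.
exists K; split; first exact: num_real.
by move=> M KM x; rewrite (le_trans (fK x))// ler_wpM2r// ltW.
Qed.

Lemma bounded_seq_linear Z (f : {linear Z -> R^o}) (z : nat -> Z) :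
  continuous (f : Z -> R^o) -> bounded_seq z ->
  bounded_seq (fun n => f (z n) : R).
Proof.
move=> /continuous_linear_norm_le[K K0 fK] [M zM]; exists (K * M) => n.
by rewrite (le_trans (fK _))// ler_wpM2l// ltW.
Qed.

End bounded_seq.

(** * Ultralimits, flat families and flat rank *)

Section ultralimit.
Context {R : realType} (U : set_system nat) {UU : UltraFilter U}.
Implicit Type Z : normedModType R.

Definition ulim (u : nat -> R) : R := lim (u @ U).

(** The image ultrafilter lives on a compact segment, so it has a cluster point, and an ultrafilter
    converges to each of its cluster points. *)
Lemma cvg_ulim (u : nat -> R) : bounded_seq u -> u @ U --> ulim u.
Proof.
move=> [M uM]; apply/cvg_ex.
have : (u @ U) `[-M, M]%classic.
  apply: (@filterE _ U _ (u @^-1` _)) => n /=.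
  by rewrite in_itv/= -ler_norml uM.
move/(@segment_compact R (- M) M (u @ U) _) => [l [_ ul]].
exists l => A lA; have [//|UA] := in_ultra_setVsetC (u @^-1` A) UU.
by have [x [/= nAx Ax]] := ul (~` A) A UA lA.
Qed.

Lemma ulimP (u : nat -> R) l : u @ U --> l -> ulim u = l.
Proof. exact: cvg_lim. Qed.

Lemma cvg_det r (A : nat -> 'M[R]_r) (B : 'M[R]_r) :
  (forall i j, A n i j @[n --> U] --> B i j) ->
  \det (A n) @[n --> U] --> \det B.
Proof.
move=> AB; rewrite /determinant; apply: cvg_big => [|s _].
  exact: add_continuous.
by apply: cvgM; [exact: cvg_cst|apply: cvg_big => [|i _]; [exact: mul_continuous|]].
Qed.

Lemma norm_cvg0_linear Z (f : {linear Z -> R^o}) (z : nat -> Z) :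
  continuous (f : Z -> R^o) -> `|z n| @[n --> U] --> (0 : R) ->
  (f (z n) : R) @[n --> U] --> (0 : R).
Proof.
move=> /continuous_linear_norm_le[K K0 fK] z0; apply/norm_cvg0P.
apply: (@squeeze_cvgr _ _ _ _ (fun=> 0) (fun n => K * `|z n|)).
- by near=> n; rewrite normr_ge0 fK.
- exact: cvg_cst.
- by rewrite -(mulr0 K); apply: cvgM => //; exact: cvg_cst.
Unshelve. all: by end_near. Qed.

(* s allows negative coefficients; only kWMLUR does. *)
Definition coefs (s : bool) (I : finType) : set (I -> R) :=
  [set t | (forall i, s || (0 <= t i)) /\ \sum_i `|t i| <= 1].

Definition flat_family (s : bool) Z (I : finType) (z : nat -> Z)
    (v : I -> nat -> Z) :=
  forall t, coefs s t ->
    `|z n + \sum_i t i *: v i n| - `|z n| @[n --> U] --> (0 : R).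

Definition ulim_mx Z r q (v : 'I_r -> nat -> Z) (f : 'I_q -> {linear Z -> R^o})
    : 'M[R]_(q, r) :=
  \matrix_(j, i) ulim (fun n => f j (v i n)).

(** Neither z nor the functionals are normalised: a coordinate of a unit vector, or the restriction
    of a unit functional to a coordinate, can have small or zero norm. *)
Definition flat_rank_ge (s c : bool) (r : nat) Z :=
  exists (z : nat -> Z) (v : 'I_r -> nat -> Z) (f : 'I_r -> {linear Z -> R^o}),
    [/\ bounded_seq z /\ (c -> forall n, z n = z 0%N),
        forall i, bounded_seq (v i), flat_family s z v,
        forall j, continuous (f j : Z -> R^o) & \det (ulim_mx v f) != 0].

(** [h] may identify indices: adding the coefficients over each fibre keeps nonnegativity and does
    not increase the sum of absolute values. *)
Lemma flat_family_comp s Z (I J : finType) (h : J -> I) z (v : I -> nat -> Z) :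
  flat_family s z v -> flat_family s z (v \o h).
Proof.
move=> vP t [t0 t1].
pose t' i := \sum_(j | h j == i) t j.
have := vP t' _; have -> : (fun n => `|z n + \sum_i t' i *: v i n| - `|z n|) =
    (fun n => `|z n + \sum_i t i *: (v \o h) i n| - `|z n|).
  apply/funext => n; congr (`|_ + _| - _); rewrite (partition_big h xpredT)//=.
  apply: eq_bigr => i _; rewrite scaler_suml.
  by apply: eq_bigr => j /eqP <-.
apply; split => [i|].
  have [//|s0/=] := boolP s; apply: sumr_ge0 => j _.
  by have := t0 j; rewrite (negPf s0).
apply: le_trans t1; rewrite [leRHS](partition_big h xpredT)//=.
by apply: ler_sum => i _; exact: ler_norm_sum.
Qed.

Lemma coefs_delta s (I : finType) (i : I) : coefs s (fun j => (j == i)%:R).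
Proof.
split => [j|]; first by rewrite ler0n orbT.
rewrite (bigD1 i)//= eqxx normr1 big1 ?addr0// => j /negPf ->.
by rewrite normr0.
Qed.

Lemma flat_family_cvg s Z (I : finType) z (v : I -> nat -> Z) t :
  bounded_seq z -> flat_family s z v -> coefs s t ->
  `|z n + \sum_i t i *: v i n| @[n --> U] --> ulim (fun n => `|z n|).
Proof.
move=> zb vP /vP zv; rewrite -[ulim _]add0r.
rewrite (_ : (fun n => _) = fun n =>
   (`|z n + \sum_i t i *: v i n| - `|z n|) + `|z n|).
  by apply: cvgD => //; exact/cvg_ulim/bounded_seq_norm.
by apply/funext => n; rewrite subrK.
Qed.

(** v_i is the difference of z + v_i and z, whose norms both tend to 0. *)
Lemma flat_family_null s Z (I : finType) z (v : I -> nat -> Z) i :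
  bounded_seq z -> flat_family s z v -> ulim (fun n => `|z n|) = 0 ->
  `|v i n| @[n --> U] --> (0 : R).
Proof.
move=> zb vP z0.
have vi n : \sum_j (j == i)%:R *: v j n = v i n.
  rewrite (bigD1 i)//= eqxx scale1r big1 ?addr0// => j /negPf ->.
  by rewrite scale0r.
have h1 := flat_family_cvg zb vP (coefs_delta s i).
have h2 := cvg_ulim (bounded_seq_norm zb).
rewrite z0 in h1 h2.
apply: (@squeeze_cvgr _ _ _ _ (fun=> 0) (fun n =>
   `|z n + \sum_j (j == i)%:R *: v j n| + `|z n|)).
- near=> n; rewrite normr_ge0/= vi.
  by rewrite -{1}(addrK (z n) (v i n)) (addrC (v i n)) ler_normB.
- exact: cvg_cst.
- by rewrite -[X in _ --> X](addr0 0); exact: cvgD.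
Unshelve. all: by end_near. Qed.

(** Only the rank of the limit matrix matters, since a nonzero minor selects suitable directions and
    functionals. This lets rank estimates for rectangular matrices be read as flat ranks. *)
Lemma flat_rank_ge_mx s (c : bool) r Z m q z (v : 'I_m -> nat -> Z)
    (f : 'I_q -> {linear Z -> R^o}) :
  bounded_seq z -> (c -> forall n, z n = z 0%N) ->
  (forall i, bounded_seq (v i)) -> flat_family s z v ->
  (forall j, continuous (f j : Z -> R^o)) ->
  (r <= \rank (ulim_mx v f))%N -> flat_rank_ge s c r Z.
Proof.
move=> zb zc vb vP fc /mxsub_det_neq0[h [g hg]].
exists z, (v \o g), (f \o h); split => //.
- by move=> i; exact: vb.
- exact: flat_family_comp.
- by move=> j; exact: fc.
- by apply: contra hg => /eqP hg; apply/eqP; rewrite -[RHS]hg; congr (\det _);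
    apply/matrixP => i j; rewrite !mxE.
Qed.

Lemma flat_rank_ge0 s c Z : flat_rank_ge s c 0 Z.
Proof.
exists (fun=> 0), (fun=> fun=> 0), (fun=> \0); split => //.
- by split => //; exact: bounded_seq_cst.
- by case.
- by move=> t _; under eq_cvg do rewrite big_ord0 addr0 subrr; exact: cvg_cst.
- by case.
- by rewrite det_mx00 oner_eq0.
Qed.

End ultralimit.

(** * Rotundity and flat rank *)

Section nearly_flat.
Context {R : realType}.
Implicit Type Z : normedModType R.

Lemma inf_gt0P (T : Type) (A : set T) (g : T -> R) :
  (forall a, A a -> 0 <= g a) ->
  0 < inf ([set 1] `|` [set g a | a in A]) <->
  exists2 d, 0 < d & forall a, A a -> d <= g a.
Proof.
move=> g0; pose B := [set 1] `|` [set g a | a in A]; split => [B0|[d d0 dg]].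
  exists (inf B) => // a Aa; apply: ge_inf; last by right; exists a.
  by exists 0 => _ [->|[b Ab <-]]; [exact: ler01|exact: g0].
apply: (@lt_le_trans _ _ (Num.min 1 d)); first by rewrite lt_min ltr01.
apply: lb_le_inf; first by exists 1; left.
move=> _ [->|[a Aa <-]]; rewrite ge_min ?lexx//.
by rewrite dg ?orbT.
Qed.

(* s = true asks for tuples with barycentre near a fixed z (kWMLUR), c = true
   alone for tuples starting at a fixed z (kWLUR). *)
Definition nearly_flat (s c : bool) k Z :=
  exists (f : 'I_k -> {linear Z -> R^o}) (e : R) (z : Z),
    [/\ 0 < e, forall j, dual_usphere (f j), c -> `|z| = 1 &
      forall d, 0 < d -> exists u : 'I_k.+1 -> Z,
        [/\ forall i, usphere (u i), e <= `|rotund_det u f|,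
          k.+1%:R - d < `|\sum_i u i| &
          (c -> if s then `|k.+1%:R *: z - \sum_i u i| < d : Prop
                else u ord0 = z)]].

Lemma usphere_mean_ge0 Z k (u : 'I_k.+1 -> Z) : (forall i, usphere (u i)) ->
  0 <= 1 - k.+1%:R^-1 * `|\sum_i u i|.
Proof.
move=> uS; rewrite subr_ge0 mulrC ler_pdivrMr// mul1r.
apply: le_trans (ler_norm_sum _ _ _) _.
under eq_bigr do rewrite uS.
by rewrite sumr_const card_ord.
Qed.

Lemma mean_ltP k (d x : R) :
  (1 - k.+1%:R^-1 * x < d / k.+1%:R) = (k.+1%:R - d < x).
Proof.
rewrite -(@ltr_pM2r _ k.+1%:R)// mulrBl mul1r divfK// mulrAC mulVf// mul1r.
by rewrite ltrBlDr ltrBlDl.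
Qed.

Lemma kWUR_nearly_flat k Z : kWUR k Z <-> ~ nearly_flat false false k Z.
Proof.
split => [H [f [e [z [e0 fS _ Hd]]]]|H e f e0 fS].
  have [|d d0 dP] := iffLR (inf_gt0P _) (H e f e0 fS).
    by move=> u [uS _]; exact: usphere_mean_ge0.
  have [u [uS ue ud _]] := Hd (d * k.+1%:R) (mulr_gt0 d0 (ltr0Sn _ _)).
  have := dP u (conj uS ue); apply/negP; rewrite -ltNge.
  by rewrite -[ltRHS](@mulfK _ k.+1%:R)// mean_ltP.
apply/inf_gt0P; first by move=> u [uS _]; exact: usphere_mean_ge0.
apply: contrapT => nd; apply: H; exists f, e, 0; split => // d d0.
apply: contrapT => nu; apply: nd; exists (d / k.+1%:R); first exact: divr_gt0.
move=> u [uS ue]; rewrite leNgt mean_ltP; apply/negP => ud; apply: nu.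
by exists u.
Qed.

Lemma cons_famE Z k (u : 'I_k.+1 -> Z) :
  cons_fam (u ord0) (fun i => u (lift ord0 i)) = u.
Proof. by apply/funext => i; rewrite /cons_fam; case: unliftP => [j|] ->. Qed.

Lemma sum_cons_fam Z k (z : Z) (zs : 'I_k -> Z) :
  \sum_i cons_fam z zs i = z + \sum_i zs i.
Proof.
rewrite big_ord_recl /cons_fam unlift_none; congr (_ + _).
by apply: eq_bigr => i _; rewrite liftK.
Qed.

Lemma usphere_cons_fam Z k (z : Z) (zs : 'I_k -> Z) :
  usphere z -> (forall i, usphere (zs i)) -> forall i, usphere (cons_fam z zs i).
Proof. by move=> zS zsS i; rewrite /cons_fam; case: unliftP => [j|] _. Qed.

Lemma kWLUR_nearly_flat k Z : kWLUR k Z <-> ~ nearly_flat false true k Z.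
Proof.
split => [H [f [e [z [e0 fS zS Hd]]]]|H z e f zS e0 fS].
  have [|d d0 dP] := iffLR (inf_gt0P _) (H z e f (zS isT) e0 fS).
    move=> u [uS _]; rewrite -sum_cons_fam; apply: usphere_mean_ge0.
    exact: usphere_cons_fam (zS isT) uS.
  have [u [uS ue ud uz]] := Hd (d * k.+1%:R) (mulr_gt0 d0 (ltr0Sn _ _)).
  have u0 : u ord0 = z by exact: uz.
  have := dP (fun i => u (lift ord0 i)); apply/not_implyP; split.
    by split => [i|]; [exact: uS|rewrite -u0 cons_famE].
  apply/negP; rewrite -ltNge -u0 -sum_cons_fam cons_famE.
  by rewrite -[ltRHS](@mulfK _ k.+1%:R)// mean_ltP.
apply/inf_gt0P.
  move=> u [uS _]; rewrite -sum_cons_fam; apply: usphere_mean_ge0.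
  exact: usphere_cons_fam zS uS.
apply: contrapT => nd; apply: H; exists f, e, z; split => // d d0.
apply: contrapT => nu; apply: nd; exists (d / k.+1%:R); first exact: divr_gt0.
move=> zs [zsS zse]; rewrite leNgt -sum_cons_fam mean_ltP; apply/negP => ud.
apply: nu; exists (cons_fam z zs); split => //; first exact: usphere_cons_fam.
by move=> _; rewrite /cons_fam unlift_none.
Qed.

Lemma kWMLUR_nearly_flat k Z : kWMLUR k Z <-> ~ nearly_flat true true k Z.
Proof.
split => [H [f [e [z [e0 fS zS Hd]]]]|H z zs zS zsS zzs f fS].
  have dn n : 0 < n.+1%:R^-1 :> R by rewrite invr_gt0.
  have /choice[u uP] n := Hd _ (dn n).
  have uS i n : usphere (u n i) by have [] := uP n.
  have uz : `|k.+1%:R *: z - \sum_i u n i| @[n --> \oo] --> (0 : R).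
    apply: (@squeeze_cvgr _ _ _ _ (fun=> 0) (@harmonic R)).
    - by near=> n; have [_ _ _ /(_ isT)/ltW] := uP n; rewrite normr_ge0.
    - exact: cvg_cst.
    - exact: cvg_harmonic.
  have /cvgr0_norm_lt/(_ _ e0) uD := H z (fun i n => u n i) (zS isT) uS uz f fS.
  have [n] := filter_ex uD; apply/negP; rewrite -leNgt.
  by have [] := uP n.
apply/cvgrPdist_lt => e e0; apply: contrapT => nD.
apply: H; exists f, e, z; split => // d d0.
have [N _ NP] : \forall n \near \oo, `|k.+1%:R *: z - \sum_i zs i n| < d.
  by have /cvgr0_norm_lt/(_ _ d0) := zzs; apply: filterS => n; rewrite normr_id.
have [n Nn nD'] : exists2 n, (N <= n)%N & e <= `|rotund_det (zs^~ n) f|.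
  apply: contrapT => nn; apply: nD; exists N => // n Nn /=.
  rewrite sub0r normrN ltNge; apply/negP => en; apply: nn; by exists n.
exists (zs^~ n); split => //; last by move=> _; exact: NP.
(* The lower bound on the norm of the sum comes for free: the sum is within d of (k+1)z, and z is a
   unit vector. *)
have := NP n Nn => /= zd.
rewrite ltrBlDl.
have -> : k.+1%:R = `|k.+1%:R *: z| :> R by rewrite normrZ zS mulr1 ger0_norm.
rewrite -ltrBlDr; apply: le_lt_trans zd.
by rewrite (le_trans _ (lerB_dist _ _)).
Unshelve. all: by end_near. Qed.

Lemma dual_usphere_scale Z (f : {linear Z -> R^o}) x0 :
  continuous (f : Z -> R^o) -> f x0 != 0 ->
  exists (a : R) (g : {linear Z -> R^o}), dual_usphere g /\ forall x, f x = a * g x :> R.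
Proof.
move=> fc fx0; have [K K0 fK] := continuous_linear_norm_le fc.
pose A := [set `|f x| | x in [set x : Z | `|x| <= 1]].
have A0 : A !=set0 by exists `|f 0|; exists 0 => //=; rewrite normr0.
have KA : ubound A K.
  by move=> _ [x /= x1 <-]; rewrite (le_trans (fK x))// ler_piMr// ltW.
have A_sup : has_sup A by split => //; exists K.
pose N := dual_norm (f : Z -> R).
have x00 : 0 < `|x0|.
  by rewrite normr_gt0; apply: contraNneq fx0 => ->; rewrite linear0.
have N0 : 0 < N.
  apply: (@lt_le_trans _ _ `|f (`|x0|^-1 *: x0)|).
    rewrite linearZ/= normrM mulr_gt0// normr_gt0//.
    by rewrite invr_eq0 gt_eqF.
  apply: ub_le_sup; first by exists K.
  exists (`|x0|^-1 *: x0) => //=.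
  by rewrite normrZ normfV normr_id mulVf// gt_eqF.
pose g : {linear Z -> R^o} := N^-1 \*: f.
have gE x : g x = N^-1 * f x :> R by [].
exists N, g; split; last by move=> x; rewrite gE mulVKf// gt_eqF.
split.
  apply: (@linear_norm_le_continuous _ _ _ (N^-1 * K)) => x.
  rewrite gE normrM ger0_norm ?invr_ge0 ?(ltW N0)// -mulrA ler_pM2l ?invr_gt0//.
have gA : [set `|g x| | x in [set x : Z | `|x| <= 1]] =
    [set N^-1 * y | y in A].
  apply/seteqP; split => [_ [x x1 <-]|_ [_ [x x1 <-] <-]].
    exists `|f x|; first by exists x.
    by rewrite gE normrM [`|N^-1|]ger0_norm// invr_ge0 ltW.
  by exists x => //; rewrite gE normrM [`|N^-1|]ger0_norm// invr_ge0 ltW.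
rewrite /dual_norm gA; apply/le_anti/andP; split.
  apply: ge_sup; first by have [y Ay] := A0; exists (N^-1 * y); exists y.
  move=> _ [y Ay <-]; rewrite ler_pdivrMl// mulr1.
  by apply: ub_le_sup => //; exists K.
rewrite -[leLHS](@mulVf _ N) ?gt_eqF// ler_pdivrMl//.
apply: ge_sup => // y Ay; rewrite -ler_pdivrMl//.
apply: ub_le_sup; last by exists y.
exists (N^-1 * K) => _ [w Aw <-]; rewrite ler_pM2l ?invr_gt0//; exact: KA.
Qed.

End nearly_flat.

(** * Nearly flat tuples and flat families are interchangeable *)

Section nearly_flat_rank.
Context {R : realType} (U : set_system nat) {UU : UltraFilter U}.
Hypothesis U_oo : \oo `<=` U.
Implicit Type Z : normedModType R.

Lemma cvg_ultra (u : nat -> R) (l : R) :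
  u @ \oo --> l -> u @ U --> l.
Proof. by move=> ul A /ul; exact: U_oo. Qed.

Lemma cvg_norm_near Z (x y : nat -> Z) (l : R) :
  `|x n - y n| @[n --> U] --> (0 : R) -> `|y n| @[n --> U] --> l ->
  `|x n| @[n --> U] --> l.
Proof.
move=> xy yl.
have h : `|x n| - `|y n| @[n --> U] --> (0 : R).
  apply/norm_cvg0P; apply: (@squeeze_cvgr _ _ _ _ (fun=> 0) (fun n => `|x n - y n|)).
  - by near=> n; rewrite normr_ge0/= ler_dist_dist.
  - exact: cvg_cst.
  - exact: xy.
rewrite -[l]add0r (_ : (fun n => _) = fun n => `|x n| - `|y n| + `|y n|).
  exact: cvgD.
by apply/funext => n; rewrite subrK.
Unshelve. all: by end_near. Qed.

(* The defect of the full sum bounds that of any convex combination. *)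
Lemma cvg_convex_norm Z k (u : 'I_k.+1 -> nat -> Z) (l : 'I_k.+1 -> R) :
  (forall i n, `|u i n| = 1) -> `|\sum_i u i n| @[n --> U] --> (k.+1%:R : R) ->
  (forall i, 0 <= l i) -> \sum_i l i = 1 ->
  `|\sum_i l i *: u i n| @[n --> U] --> (1 : R).
Proof.
move=> u1 uk l0 l1.
have l_le1 i : l i <= 1 by rewrite -l1 (bigD1 i)//= lerDl sumr_ge0.
have dk : \sum_(i < k.+1) (1 - l i) = k%:R.
  by rewrite sumrB l1 sumr_const card_ord -natr1 addrK.
apply: (@squeeze_cvgr _ _ _ _ (fun n => `|\sum_i u i n| - k%:R) (fun=> 1)).
- near=> n; apply/andP; split.
    rewrite lerBlDr; have -> : \sum_i u i n =
        \sum_i l i *: u i n + \sum_i (1 - l i) *: u i n.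
      rewrite -big_split/=; apply: eq_bigr => i _.
      by rewrite -scalerDl addrC subrK scale1r.
    apply: le_trans (ler_normD _ _) _; rewrite lerD2l -dk.
    apply: le_trans (ler_norm_sum _ _ _) _; apply: ler_sum => i _.
    by rewrite normrZ u1 mulr1 ger0_norm// subr_ge0.
  apply: le_trans (ler_norm_sum _ _ _) _; rewrite -l1; apply: ler_sum => i _.
  by rewrite normrZ u1 mulr1 ger0_norm.
- have k1 : k.+1%:R - k%:R = 1 :> R by rewrite -natr1 addrAC subrr add0r.
  by rewrite -[X in _ --> X]k1; apply: cvgB => //; exact: cvg_cst.
- exact: cvg_cst.
Unshelve. all: by end_near. Qed.

Lemma cvg_rotund_det Z k (u : nat -> 'I_k.+1 -> Z) (f : 'I_k -> {linear Z -> R^o})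
    (a : 'I_k -> 'I_k.+1 -> R) :
  (forall j i, (f j (u n i) : R) @[n --> U] --> a j i) ->
  rotund_det (u n) f @[n --> U] -->
  \det (\matrix_(j < k.+1, i < k.+1)
         (if unlift ord0 j is Some j' then a j' i else 1) : 'M[R]_k.+1).
Proof.
move=> ua; apply: cvg_det => j i; rewrite mxE.
rewrite [X in X @ _](_ : _ = fun n =>
    if unlift ord0 j is Some j' then f j' (u n i) else 1); last first.
  by apply/funext => n; rewrite mxE.
by case: (unlift ord0 j) => [j'|]; [exact: ua|exact: cvg_cst].
Qed.

(** The row of ones forces the coefficients of a kernel vector to sum to 0, so the determinant
    vanishes exactly when the k+1 columns of [a] are affinely dependent. *)
Lemma rotund_mx_det_eq0 k (a : 'I_k -> 'I_k.+1 -> R) :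
  \det (\matrix_(j < k.+1, i < k.+1)
         (if unlift ord0 j is Some j' then a j' i else 1) : 'M[R]_k.+1) = 0 <->
  exists2 c : 'I_k.+1 -> R, exists i, c i != 0 &
    \sum_i c i = 0 /\ forall j, \sum_i c i * a j i = 0.
Proof.
split => [/eqP/det_eq0P[c c0 cM]|[c c0 [cs ca]]].
  exists c => //; split => [|j].
    rewrite -[RHS](cM ord0); apply: eq_bigr => i _.
    by rewrite mxE unlift_none mulr1.
  rewrite -[RHS](cM (lift ord0 j)); apply: eq_bigr => i _.
  by rewrite mxE liftK.
apply/eqP/det_eq0P; exists c => // j.
under eq_bigr do rewrite mxE.
by case: (unliftP ord0 j) => [j'|] _ //; under eq_bigr do rewrite mulr1.
Qed.

(** The directions are differences between the unit vectors and the base, so that the points of the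
    flat family are, up to a null error, convex combinations of the tuple; an affine determinant
    bounded away from 0 makes these differences independent in the limit. *)
Lemma nearly_flat_rank (s c : bool) k Z : (s -> c) ->
  nearly_flat s c k Z -> flat_rank_ge U s c k Z.
Proof.
move=> sc [f [e [z [e0 fS zS Hd]]]].
have dn n : 0 < n.+1%:R^-1 :> R by rewrite invr_gt0.
have /choice[u0 uP] n := Hd _ (dn n).
pose u i n := u0 n i.
have uS i n : `|u i n| = 1 by have [+ _ _ _] := uP n; apply.
have fc j : continuous (f j : Z -> R^o) by have [] := fS j.
have ub i : bounded_seq (u i) by exists 1 => n; rewrite uS.
have uk : `|\sum_i u i n| @[n --> U] --> (k.+1%:R : R).
  apply: cvg_ultra.
  apply: (@squeeze_cvgr _ _ _ _ (fun n => k.+1%:R - harmonic n) (fun=> k.+1%:R)).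
  - near=> n; have [_ _ /ltW un _] := uP n; rewrite un/=.
    apply: le_trans (ler_norm_sum _ _ _) _; under eq_bigr do rewrite uS.
    by rewrite sumr_const card_ord.
  - rewrite -[X in _ --> X]subr0; apply: cvgB; first exact: cvg_cst.
    exact: cvg_harmonic.
  - exact: cvg_cst.
(* The base is asymptotically the convex combination of the tuple with weights [b]: its mean if [s]
   holds, its first vector otherwise. *)
pose b (i : 'I_k.+1) : R := if s then k.+1%:R^-1 else (i == ord0)%:R.
(* This choice gives (1 - al) / (k+1) = al when [s] holds, so the weights [l] below stay nonnegative
   even for a coefficient equal to -1. *)
pose al : R := if s then k.+2%:R^-1 else 1.
pose base n := if s then z else u ord0 n.
have al0 : 0 < al by rewrite /al; case: (s); rewrite ?invr_gt0.
have b_ge0 i : 0 <= b i by rewrite /b; case: (s); rewrite ?invr_ge0 ?ler0n.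
have b1 : \sum_(i < k.+1) b i = 1.
  rewrite /b; case: (s); first by rewrite sumr_const card_ord -[LHS]mulr_natr mulVf.
  by rewrite (bigD1 ord0)//= big1 ?addr0// => i /negPf ->.
have baseP : `|base n - \sum_i b i *: u i n| @[n --> U] --> (0 : R).
  rewrite /base /b; have [sT|sF] := boolP s; last first.
    rewrite [X in X @ _](_ : _ = fun=> 0); first exact: cvg_cst.
    apply/funext => n; rewrite (bigD1 ord0)//= scale1r big1 ?addr0 ?subrr ?normr0//.
    by move=> i /negPf ->; rewrite scale0r.
  apply: cvg_ultra.
  apply: (@squeeze_cvgr _ _ _ _ (fun=> 0) (@harmonic R)).
  - near=> n; rewrite normr_ge0/=; have [_ _ _ /(_ (sc sT))] := uP n.
    rewrite sT => un; apply: le_trans (ltW un).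
    rewrite -scaler_sumr -[X in `|X - _|](@scalerK _ _ k.+1%:R)// -scalerBr normrZ.
    by rewrite ger0_norm ?invr_ge0// ler_piMl// invf_le1// ler1n.
  - exact: cvg_cst.
  - exact: cvg_harmonic.
have bb : bounded_seq base.
  by rewrite /base; case: (s); [exact: bounded_seq_cst|exact: ub].
pose v i n := al *: (u (lift ord0 i) n - base n).
have vb i : bounded_seq (v i) by apply: bounded_seqZ; exact: bounded_seqB.
have base1 : `|base n| @[n --> U] --> (1 : R).
  by apply: cvg_norm_near baseP _; exact: cvg_convex_norm.
exists base, v, f; split => //.
- split => // cT n; rewrite /base; case: ifPn => // sF.
  have [_ _ _ /(_ cT)] := uP n; have [_ _ _ /(_ cT)] := uP 0%N.
  by rewrite (negPf sF) /u => -> ->.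
- move=> t [t0 t1].
  pose T := \sum_i t i.
  pose l (i : 'I_k.+1) := (1 - al * T) * b i + (if unlift ord0 i is Some i' then al * t i' else 0).
  have Tle : `|T| <= 1 by apply: le_trans t1; exact: ler_norm_sum.
  have l1 : \sum_i l i = 1.
    rewrite /l big_split/= -mulr_sumr b1 mulr1 big_ord_recl unlift_none add0r.
    under eq_bigr do rewrite liftK.
    by rewrite -mulr_sumr subrK.
  have l0 i : 0 <= l i.
    have := t0; rewrite /l /al /b; have [_ _|_ /= {}t0] := boolP s.
      have T1 : T <= 1 by move: Tle; rewrite ler_norml => /andP[].
      have k0 : 0 < k.+1%:R :> R by rewrite ltr0n.
      have k2 : k.+2%:R = k.+1%:R + 1 :> R by rewrite -natr1.
      have h1 : k.+2%:R^-1 <= (1 - k.+2%:R^-1 * T) * k.+1%:R^-1 :> R.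
        rewrite ler_pdivlMr// k2 lerBrDr -mulrDr ler_pdivrMl ?addr_gt0//.
        by rewrite mulr1 lerD2l.
      case: (unlift ord0 i) => [i'|]; last first.
        by rewrite addr0; apply: le_trans h1; rewrite invr_ge0.
      have ti : - 1 <= t i'.
        suff : `|t i'| <= 1 by rewrite ler_norml => /andP[].
        by apply: le_trans t1; rewrite (bigD1 i')//= lerDl sumr_ge0.
      apply: le_trans (lerD h1 (ler_wpM2l (_ : 0 <= k.+2%:R^-1) ti)).
        by rewrite mulrN1 subrr.
      by rewrite invr_ge0.
    have T1 : T <= 1 by move: Tle; rewrite ler_norml => /andP[].
    rewrite !mul1r addr_ge0 ?mulr_ge0 ?subr_ge0//.
    by case: (unlift ord0 i) => [i'|//]; rewrite mul1r.
  have lE n : base n + \sum_i t i *: v i n - \sum_i l i *: u i n =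
      (1 - al * T) *: (base n - \sum_i b i *: u i n).
    rewrite /l; under [X in _ - X]eq_bigr do rewrite scalerDl -scalerA.
    rewrite big_split/= -scaler_sumr [X in _ - (_ + X)]big_ord_recl unlift_none.
    rewrite scale0r add0r.
    under [X in _ - (_ + X)]eq_bigr do rewrite liftK.
    have -> : \sum_i t i *: v i n =
        \sum_i (al * t i) *: u (lift ord0 i) n - (al * T) *: base n.
      rewrite /T mulr_sumr scaler_suml -sumrB; apply: eq_bigr => i _.
      by rewrite /v scalerA mulrC scalerBr.
    rewrite scalerBr [in RHS]scalerBl scale1r [X in _ + X - _]addrC addrA.
    by rewrite opprD addrACA subrr addr0.
  rewrite -[X in _ --> X](subrr (1 : R)); apply: cvgB => //.
  apply: (@cvg_norm_near _ _ (fun n => \sum_i l i *: u i n)); last first.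
    exact: cvg_convex_norm.
  rewrite [X in X @ _](_ : _ = fun n =>
      `|1 - al * T| * `|base n - \sum_i b i *: u i n|); last first.
    by apply/funext => n; rewrite lE normrZ.
  by rewrite -[X in _ --> X](mulr0 `|1 - al * T|); apply: cvgM => //; exact: cvg_cst.
- apply/negP => /det_eq0P[g [i0 gi0] gP].
  pose a j (i : 'I_k.+1) := ulim U (fun n => f j (u i n)).
  have fa j i : (f j (u i n) : R) @[n --> U] --> a j i.
    by apply: cvg_ulim; apply: bounded_seq_linear.
  have fbase j : (f j (base n) : R) @[n --> U] --> \sum_i b i * a j i.
    rewrite -[X in _ --> X]add0r.
    rewrite [X in X @ _](_ : _ = fun n => (f j (base n - \sum_i b i *: u i n) : R) +
        \sum_i b i * (f j (u i n) : R)); last first.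
      apply/funext => n; rewrite linearB/= linear_sum/=.
      under [X in _ - X]eq_bigr do rewrite linearZ/=.
      by rewrite subrK.
    apply: cvgD; first exact: norm_cvg0_linear.
    apply: cvg_big => [|i _]; first exact: add_continuous.
    by apply: cvgM => //; exact: cvg_cst.
  have vE j i : ulim_mx U v f j i = al * (a j (lift ord0 i) - \sum_i b i * a j i).
    rewrite mxE; apply: ulimP.
    rewrite [X in X @ _](_ : _ = fun n =>
        al * ((f j (u (lift ord0 i) n) : R) - (f j (base n) : R))); last first.
      by apply/funext => n; rewrite linearZ/= linearB.
    by apply: cvgM; [exact: cvg_cst|exact: cvgB].
  have := cvg_rotund_det (u := u0) fa.
  set L := \det _ => DL.
  have eL : e <= `|L|.
    apply: (cvgr_to_ge (cvg_norm DL)); near=> n.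
    by have [] := uP n.
  suff L0 : L = 0 by move: eL; rewrite L0 normr0 leNgt e0.
  apply/rotund_mx_det_eq0.
  pose G := \sum_i g i.
  (* These are the coefficients of the combination of the differences u_i - base once the base is
     expanded with weights [b]. They sum to 0. They cannot all vanish: as [b ord0] is nonzero, G
     would be 0, and then so would every [g i]. *)
  exists (fun i => (if unlift ord0 i is Some i' then g i' else 0) - G * b i).
    apply/not_existsP => H.
    have {}H i : (if unlift ord0 i is Some i' then g i' else 0) = G * b i.
      by apply/eqP; rewrite -subr_eq0; apply/negPn/negP; exact: H.
    have := H ord0; rewrite unlift_none => /esym/eqP; rewrite mulf_eq0.
    have -> : (b ord0 == 0) = false.
      by rewrite /b; case: (s); rewrite ?eqxx ?oner_eq0 ?invr_eq0 ?pnatr_eq0.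
    rewrite orbF => /eqP G0; have := H (lift ord0 i0).
    by rewrite liftK G0 mul0r => /eqP; rewrite (negPf gi0).
  split => [|j].
    rewrite sumrB -mulr_sumr b1 mulr1 big_ord_recl unlift_none add0r.
    by under eq_bigr do rewrite liftK; rewrite subrr.
  under eq_bigr do rewrite mulrBl.
  rewrite sumrB big_ord_recl unlift_none mul0r add0r.
  under eq_bigr do rewrite liftK.
  under [X in _ - X]eq_bigr do rewrite -mulrA.
  rewrite -mulr_sumr /G mulr_suml -sumrB.
  apply: (mulfI (lt0r_neq0 al0)); rewrite mulr0 mulr_sumr -[RHS](gP j).
  by apply: eq_bigr => i _; rewrite vE; ring.
Unshelve. all: by end_near. Qed.

(** An invertible matrix has no zero row, so no functional vanishes and each can be divided by its
    norm. This only scales the rows of the limit matrix. *)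
Lemma flat_rank_usphere s c k Z : flat_rank_ge U s c k Z ->
  exists z (v : 'I_k -> nat -> Z) (f : 'I_k -> {linear Z -> R^o}),
    [/\ bounded_seq z /\ (c -> forall n, z n = z 0%N),
        forall i, bounded_seq (v i), flat_family U s z v,
        forall j, dual_usphere (f j) & \det (ulim_mx U v f) != 0].
Proof.
move=> [z [v [f [zb vb vP fc df]]]].
have fv j i : (f j (v i n) : R) @[n --> U] --> ulim_mx U v f j i.
  by rewrite mxE; apply: cvg_ulim; exact: bounded_seq_linear.
have f0 j : exists x, f j x != 0.
  apply/not_existsP => H; move/negP: df; apply; rewrite (expand_det_row _ j) big1// => i _.
  rewrite (_ : ulim_mx U v f j i = 0) ?mul0r// mxE; apply: ulimP.
  rewrite [X in X @ _](_ : _ = fun=> 0); first exact: cvg_cst.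
  by apply/funext => n; apply/eqP/negPn/negP; exact: H.
have /choice[a /choice[g gP]] j := dual_usphere_scale (fc j) (projT2 (cid (f0 j))).
exists z, v, g; split => //; first by move=> j; have [] := gP j.
apply: contra df => /eqP dg.
have gv j i : (g j (v i n) : R) @[n --> U] --> ulim_mx U v g j i.
  rewrite mxE; apply: cvg_ulim; apply: bounded_seq_linear => //.
  by have [[]] := gP j.
have -> : ulim_mx U v f = diag_mx (\row_j a j) *m ulim_mx U v g.
  apply/matrixP => j i; rewrite mul_diag_mx !mxE.
  apply: ulimP; have := gv j i; rewrite mxE => gvji.
  rewrite [X in X @ _](_ : _ = fun n => a j * (g j (v i n) : R)); last first.
    by apply/funext => n; have [_ ->] := gP j.
  by apply: cvgM => //; exact: cvg_cst.
by rewrite det_mulmx dg mulr0.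
Qed.

(* z - sum v / k and the z + v_i / k have mean z; without negative
   coefficients, z and the z + v_i are used instead. *)
Lemma rank_nearly_flat (s c : bool) k Z : (s -> c) -> (0 < k)%N ->
  flat_rank_ge U s c k Z -> nearly_flat s c k Z.
Proof.
move=> sc k0 /flat_rank_usphere[z [v [f [[zb zc] vb vP fS df]]]].
have fc j : continuous (f j : Z -> R^o) by have [] := fS j.
set M := ulim_mx U v f in df.
have fv j i : (f j (v i n) : R) @[n --> U] --> M j i.
  by rewrite mxE; apply: cvg_ulim; exact: bounded_seq_linear.
pose C := ulim U (fun n => `|z n|).
have zC : `|z n| @[n --> U] --> C := cvg_ulim (UU := UU) (bounded_seq_norm zb).
(* If the base were null, the v_i would be null as well, and a row of the limit matrix would be
   zero; there is a row because k > 0. *)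
have C0 : 0 < C.
  rewrite lt_neqAle; apply/andP; split; last first.
    by apply: (cvgr_to_ge zC); near=> n.
  apply: contra df => /eqP/esym Cz; pose i0 := Ordinal k0.
  rewrite (expand_det_row _ i0) big1// => i _.
  rewrite (_ : M i0 i = 0) ?mul0r// mxE; apply: ulimP.
  apply: norm_cvg0_linear => //; exact: flat_family_null vP Cz.
(* The factor 1/k gives the coefficient vector of z - sum v / k total absolute value k * (1/k) = 1,
   as admissibility requires. *)
pose ka : R := if s then k%:R^-1 else 1.
have ka0 : 0 < ka by rewrite /ka; case: (s); rewrite ?invr_gt0 ?ltr0n.
pose tt (i : 'I_k.+1) (j : 'I_k) : R :=
  if unlift ord0 i is Some i' then (j == i')%:R * ka else if s then - ka else 0.
have ttP i : coefs s (tt i).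
  split => [j|].
    rewrite /tt; case: (unlift ord0 i) => [i'|]; last by case: (s); rewrite /= ?lexx.
    by rewrite mulr_ge0 ?orbT// ?ler0n// ltW.
  rewrite /tt; case: (unlift ord0 i) => [i'|].
    rewrite (bigD1 i')//= eqxx mul1r big1 ?addr0.
      rewrite ger0_norm ?(ltW ka0)// /ka; case: (s) => //.
      by rewrite invf_le1 ?ltr0n// ler1n.
    by move=> j /negPf ->; rewrite mul0r normr0.
  have [sT|sF] := boolP s; last first.
    by rewrite big1 ?ler01// => j _; rewrite normr0.
  rewrite sumr_const card_ord normrN ger0_norm ?(ltW ka0)// /ka sT.
  by rewrite -[leLHS]mulr_natr mulVf// pnatr_eq0 -lt0n.
have tt_sum j : \sum_i tt i j = if s then 0 else 1.
  rewrite big_ord_recl /tt unlift_none.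
  under eq_bigr do rewrite liftK eq_sym.
  rewrite -mulr_suml (bigD1 j)//= eqxx big1 ?addr0 ?mul1r; last first.
    by move=> i /negPf ->.
  by rewrite /ka; case: (s); rewrite ?addNr ?add0r.
pose w i n := z n + \sum_j tt i j *: v j n.
have wC i : `|w i n| @[n --> U] --> C by exact: flat_family_cvg zb vP (ttP i).
have wsum n : \sum_i w i n =
    k.+1%:R *: (z n + \sum_j (if s then 0 else k.+1%:R^-1) *: v j n).
  rewrite /w big_split/= sumr_const card_ord scalerDr scaler_nat; congr (_ + _).
  rewrite exchange_big/= scaler_sumr; apply: eq_bigr => j _.
  rewrite -scaler_suml tt_sum scalerA; congr (_ *: _).
  by case: (s); rewrite ?mulr0 ?mulfV.
have wkC : `|\sum_i w i n| @[n --> U] --> k.+1%:R * C.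
  rewrite [X in X @ _](_ : _ = fun n =>
    k.+1%:R * `|z n + \sum_j (if s then 0 else k.+1%:R^-1) *: v j n|); last first.
    by apply/funext => n; rewrite wsum normrZ ger0_norm.
  apply: cvgM; first exact: cvg_cst.
  apply: (flat_family_cvg (t := fun=> if s then 0 else k.+1%:R^-1) zb vP).
  split => [j|]; first by case: (s); rewrite ?invr_ge0 ?ler0n ?orbT.
  rewrite sumr_const card_ord; case: (s); first by rewrite normr0 mul0rn.
  rewrite ger0_norm ?invr_ge0// -[leLHS]mulr_natr mulrC ler_pdivrMr// mul1r.
  by rewrite ler_nat.
(* Exact normalisation puts the tuple on the sphere. Since every |w_i| tends to the same C, u_i is
   asymptotically w_i / C, and one common factor preserves linear relations between the w_i. *)
pose u i n := `|w i n|^-1 *: w i n.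
have wV i : `|w i n|^-1 @[n --> U] --> C^-1 by apply: cvgV => //; rewrite gt_eqF.
have uw i : `|u i n - C^-1 *: w i n| @[n --> U] --> (0 : R).
  rewrite [X in X @ _](_ : _ = fun n => `|(`|w i n|^-1 - C^-1)| * `|w i n|); last first.
    by apply/funext => n; rewrite -normrZ scalerBl.
  rewrite -[X in _ --> X](mul0r C); apply: cvgM => //.
  apply/norm_cvg0P; rewrite -[X in _ --> X](subrr C^-1).
  by apply: cvgB => //; exact: cvg_cst.
have uwsum : `|\sum_i u i n - C^-1 *: \sum_i w i n| @[n --> U] --> (0 : R).
  apply: (@squeeze_cvgr _ _ _ _ (fun=> 0)
      (fun n => \sum_i `|u i n - C^-1 *: w i n|)).
  - near=> n; rewrite normr_ge0/= scaler_sumr -sumrB; exact: ler_norm_sum.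
  - exact: cvg_cst.
  - have s0 : \sum_(i < k.+1) (0 : R) = 0 by rewrite big1.
    rewrite -[X in _ --> X]s0.
    by apply: cvg_big => [|i _]; [exact: add_continuous|exact: uw].
have uk : `|\sum_i u i n| @[n --> U] --> (k.+1%:R : R).
  apply: cvg_norm_near uwsum _.
  rewrite [X in X @ _](_ : _ = fun n => C^-1 * `|\sum_i w i n|); last first.
    by apply/funext => n; rewrite normrZ ger0_norm// invr_ge0 ltW.
  rewrite -[X in _ --> X](mulfK (lt0r_neq0 C0)) mulrC.
  by apply: cvgM => //; exact: cvg_cst.
have fz j : (f j (z n) : R) @[n --> U] --> ulim U (fun n => f j (z n)).
  by apply: cvg_ulim; exact: bounded_seq_linear.
pose a j (i : 'I_k.+1) := C^-1 *
  (ulim U (fun n => f j (z n)) + \sum_l tt i l * M j l).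
have fu j i : (f j (u i n) : R) @[n --> U] --> a j i.
  rewrite [X in X @ _](_ : _ = fun n => `|w i n|^-1 *
    ((f j (z n) : R) + \sum_l tt i l * (f j (v l n) : R))); last first.
    apply/funext => n; rewrite linearZ/=; congr (_ *: _).
    rewrite linearD linear_sum; congr (_ + _).
    by apply: eq_bigr => l _; rewrite linearZ.
  apply: cvgM => //; apply: cvgD => //.
  apply: cvg_big => [|l _]; first exact: add_continuous.
  by apply: cvgM => //; exact: cvg_cst.
have DL := cvg_rotund_det (u := fun n i => u i n) fu.
set L := \det _ in DL.
have L0 : L != 0.
  (* In an affine dependence [g] the base cancels, and invertibility of [M] kills the coefficient
     [G l] of each direction. Hence [g] is constant if [s] holds and supported at index 0 otherwise;
     as its sum is 0, it vanishes. *)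
  apply/eqP => /rotund_mx_det_eq0[g [i0 gi0] [gs ga]].
  pose G l := \sum_i g i * tt i l.
  have GM j : \sum_l G l * M j l = 0.
    have := ga j; under eq_bigr do rewrite /a mulrCA mulrDr.
    rewrite -mulr_sumr big_split/= -mulr_suml gs mul0r add0r => /eqP.
    rewrite mulf_eq0 invr_eq0 gt_eqF//= => /eqP h; rewrite -[RHS]h.
    under [RHS]eq_bigr do rewrite mulr_sumr.
    rewrite exchange_big/=; apply: eq_bigr => l _; rewrite /G mulr_suml.
    by apply: eq_bigr => i _; rewrite mulrA.
  have G0 l : G l = 0.
    apply/eqP/negPn/negP => Gl; move/negP: df; apply.
    by apply/det_eq0P; exists G => //; exists l.
  have gl l : g (lift ord0 l) = if s then g ord0 else 0.
    have := G0 l; rewrite /G big_ord_recl /tt unlift_none.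
    under eq_bigr do rewrite liftK.
    rewrite (bigD1 l)//= eqxx mul1r big1 ?addr0; last first.
      by move=> i; rewrite eq_sym => /negPf ->; rewrite mul0r mulr0.
    case: (s) => [/eqP|/eqP]; last first.
      by rewrite mulr0 add0r mulf_eq0 (gt_eqF ka0) orbF => /eqP.
    rewrite mulrN addrC subr_eq0 => /eqP/(mulIf (lt0r_neq0 ka0)).
    by [].
  have g0 : g ord0 = 0.
    move: gs; rewrite big_ord_recl; under eq_bigr do rewrite gl.
    rewrite sumr_const card_ord; case: (s); last by rewrite mul0rn addr0.
    by rewrite -mulrS => /eqP; rewrite mulrn_eq0/= => /eqP.
  move: gi0; case: (unliftP ord0 i0) => [l|] ->; last by rewrite g0 eqxx.
  by rewrite gl; case: (s); rewrite ?g0 eqxx.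
(* If [c] holds, z is constant, so its norm is exactly C and z / C is a unit vector; otherwise 0 is
   a placeholder. *)
pose zz := if c then C^-1 *: z 0%N else 0.
have zn n : c -> `|z n| = C.
  move=> /zc zc'; rewrite zc'; apply/esym/ulimP.
  rewrite [X in X @ _](_ : _ = fun=> `|z 0%N|); first exact: cvg_cst.
  by apply/funext => m; rewrite zc'.
exists f, (`|L| / 2), zz; split => //.
- by rewrite divr_gt0// normr_gt0.
- by move=> cT; rewrite /zz cT normrZ zn// ger0_norm ?mulVf ?invr_ge0 ?gt_eqF// ltW.
move=> d d0.
have uwd : \forall n \near U, `|\sum_i u i n - C^-1 *: \sum_i w i n| < d.
  by have /cvgr0_norm_lt/(_ _ d0) := uwsum; apply: filterS => n; rewrite normr_id.
have w0 : \forall n \near U, forall i, 0 < `|w i n|.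
  by apply: filter_forall => i; apply: (cvgr_gt _ (wC i)).
have De : \forall n \near U, `|L| / 2 <= `|rotund_det (fun i => u i n) f|.
  apply: (cvgr_ge _ (cvg_norm DL)).
  by rewrite ltr_pdivrMr// ltr_pMr ?normr_gt0// ltr1n.
have ud : \forall n \near U, k.+1%:R - d < `|\sum_i u i n|.
  by apply: (cvgr_gt _ uk); rewrite ltrBlDr ltrDl.
have [n [n1 n2 n3 n4]] : exists n, [/\ `|\sum_i u i n - C^-1 *: \sum_i w i n| < d,
    forall i, 0 < `|w i n|, `|L| / 2 <= `|rotund_det (fun i => u i n) f| &
    k.+1%:R - d < `|\sum_i u i n|].
  by apply: (@filter_ex _ U); near=> n; split; near: n.
exists (fun i => u i n); split => //.
  by move=> i; rewrite /usphere/= normrZ normfV normr_id mulVf// gt_eqF.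
move=> cT; rewrite /zz cT; have [sT|sF] := boolP s; last first.
  rewrite /u /w /tt unlift_none (negPf sF) big1; last by move=> j _; rewrite scale0r.
  by rewrite addr0 zn// zc.
have wz : \sum_i w i n = k.+1%:R *: z n.
  by rewrite wsum sT [X in z n + X]big1 ?addr0// => j _; rewrite scale0r.
by move: n1; rewrite wz distrC (zc cT n) scalerA mulrC -scalerA.
Unshelve. all: by end_near. Qed.

Lemma kWUR_flat_rank k Z : (0 < k)%N ->
  kWUR k Z <-> ~ flat_rank_ge U false false k Z.
Proof.
move=> k0; rewrite kWUR_nearly_flat; split; apply: contra_not.
  exact: rank_nearly_flat.
exact: nearly_flat_rank.
Qed.

Lemma kWLUR_flat_rank k Z : (0 < k)%N ->
  kWLUR k Z <-> ~ flat_rank_ge U false true k Z.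
Proof.
move=> k0; rewrite kWLUR_nearly_flat; split; apply: contra_not.
  exact: rank_nearly_flat.
exact: nearly_flat_rank.
Qed.

Lemma kWMLUR_flat_rank k Z : (0 < k)%N ->
  kWMLUR k Z <-> ~ flat_rank_ge U true true k Z.
Proof.
move=> k0; rewrite kWMLUR_nearly_flat; split; apply: contra_not.
  exact: rank_nearly_flat.
exact: nearly_flat_rank.
Qed.

End nearly_flat_rank.

(** * Norm and functionals of an l_p-product *)

(** Strict Bernoulli inequality. With x = exp u it combines exp y > 1 + y at y = (p-1)u and at y =
    -u, each multiplied by exp u. *)
Lemma powR_gt_tangent (R : realType) (p x : R) :
  1 < p -> 0 <= x -> x != 1 -> 1 + p * (x - 1) < x `^ p.
Proof.
move=> p1; rewrite le_eqVlt => /predU1P[<- _|x0 x1].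
  by rewrite powR0 ?gt_eqF ?(lt_trans ltr01)//; lra.
have u0 : ln x != 0 by rewrite ln_eq0.
rewrite /powR gt_eqF//; set u := ln x in u0 *.
have -> : x = expR u by rewrite lnK// posrE.
have h1 : 1 + (p - 1) * u < expR ((p - 1) * u).
  by apply: expR_gt1Dx; rewrite mulf_neq0// subr_eq0 gt_eqF.
have h2 : 1 - u < expR (- u) by apply: expR_gt1Dx; rewrite oppr_eq0.
have e0 : 0 < expR u := expR_gt0 u.
have -> : expR (p * u) = expR u * expR ((p - 1) * u).
  by rewrite -expRD; congr expR; ring.
have h3 : expR u * expR (- u) = 1 by rewrite -expRD subrr expR0.
rewrite -(ltr_pM2l e0) in h1; rewrite -(ltr_pM2l e0) h3 in h2.
have {h2}h2 : (p - 1) * (expR u * (1 - u)) < p - 1.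
  by rewrite -[ltRHS]mulr1 ltr_pM2l ?subr_gt0.
lra.
Qed.

(** The tangent inequalities at the midpoint, rescaled to the point 1, are added; their linear terms
    cancel. *)
Lemma powR_midpoint_lt (R : realType) (p a b : R) :
  1 < p -> 0 <= a -> 0 <= b -> a != b ->
  2 * ((a + b) / 2) `^ p < a `^ p + b `^ p.
Proof.
move=> p1 a0 b0 ab; set m := (a + b) / 2.
have m0 : 0 < m.
  rewrite divr_gt0// lt_neqAle addr_ge0// andbT eq_sym paddr_eq0//.
  by apply: contra ab => /andP[/eqP-> /eqP->].
have scaled c : 0 <= c -> c != m ->
    m `^ p * (1 + p * (c / m - 1)) < c `^ p.
  move=> c0 cm; have -> : c `^ p = m `^ p * (c / m) `^ p.
    have cE : c = m * (c / m) by rewrite mulrC divfK// gt_eqF.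
    by rewrite {1}cE powRM// ?(divr_ge0 c0)// (ltW m0).
  rewrite ltr_pM2l ?powR_gt0//; apply: powR_gt_tangent => //.
    by rewrite divr_ge0// ltW.
  by apply: contra cm => /eqP cm1; rewrite -(divfK (lt0r_neq0 m0) c) cm1 mul1r.
have am : a != m.
  by apply: contra ab => /eqP am; apply/eqP; rewrite /m in am; lra.
have bm : b != m.
  by apply: contra ab => /eqP bm; apply/eqP; rewrite /m in bm; lra.
apply: le_lt_trans (ltrD (scaled _ a0 am) (scaled _ b0 bm)).
rewrite -mulrDr mulrC ler_pM2l ?powR_gt0//.
have -> : 1 + p * (a / m - 1) + (1 + p * (b / m - 1)) =
          2 + p * ((a + b) / m - 2) by ring.
suff -> : (a + b) / m = 2 by rewrite subrr mulr0 addr0.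
have -> : a + b = 2 * m by rewrite /m; field.
by rewrite mulfK// gt_eqF.
Qed.

Lemma powR_midpoint_le (R : realType) (p a b : R) :
  1 < p -> 0 <= a -> 0 <= b -> 2 * ((a + b) / 2) `^ p <= a `^ p + b `^ p.
Proof.
move=> p1 a0 b0; have [->|ab] := eqVneq a b; last exact/ltW/powR_midpoint_lt.
have -> : (b + b) / 2 = b by field.
by rewrite mulrC mulr_natr mulr2n.
Qed.

Lemma powR_le_cancel (R : realType) (p a b : R) :
  0 < p -> 0 <= a -> 0 <= b -> a `^ p <= b `^ p -> a <= b.
Proof.
move=> p0 a0 b0; apply: contraTT; rewrite -!ltNge.
by apply: gt0_ltr_powR; rewrite ?nnegrE.
Qed.

Lemma powR_cancel (R : realType) (p a b : R) :
  0 < p -> 0 <= a -> 0 <= b -> a `^ p = b `^ p -> a = b.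
Proof.
move=> p0 a0 b0 ab; apply/le_anti/andP.
by split; apply: (@powR_le_cancel _ p); rewrite // ab.
Qed.

(** * Coordinates, embeddings and truncations *)

Section lp_coordinates.
Context {R : realType} {X : nat -> completeNormedModType R} {p : R}.
Variable (p1 : 1 <= p).
Local Notation Xp := (lp_product X p1).
Implicit Types x y : Xp.

Let p0 : 0 < p. Proof. exact: lt_le_trans p1. Qed.

Lemma lp_norm_powR x : ((`|x| `^ p)%:E = lp_sum p x)%E.
Proof.
rewrite lp_normrE /lp_norm -powRrM mulVf ?gt_eqF// powRr1; last first.
  exact/fine_ge0/lp_sum_ge0.
by rewrite fineK// ge0_fin_numE ?lp_sum_ge0//; exact: lp_sum_fin.
Qed.

Lemma lp_norm_powR_ge x n : \sum_(i < n) `|x i| `^ p <= `|x| `^ p.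
Proof. exact: lp_norm_sum_le. Qed.

Lemma lp_norm_powR_le x N M :
  (forall n, (N <= n)%N -> \sum_(i < n) `|x i| `^ p <= M) -> `|x| `^ p <= M.
Proof.
move=> xM; rewrite -lee_fin lp_norm_powR; apply: lp_sum_ub => n.
rewrite lee_fin (le_trans _ (xM (n + N)%N _)) ?leq_addl//.
rewrite -!(big_mkord xpredT (fun i => `|x i| `^ p)).
rewrite [leRHS](big_cat_nat _ (leq_addr N n))//= lerDl sumr_ge0//.
Qed.

Lemma lp_normD_disjoint x y : (forall i, x i = 0 \/ y i = 0) ->
  `|x + y| `^ p = `|x| `^ p + `|y| `^ p.
Proof.
move=> xy; apply: EFin_inj; rewrite EFinD.
rewrite [LHS]lp_norm_powR [X in (X + _)%E]lp_norm_powR [X in (_ + X)%E]lp_norm_powR.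
rewrite /lp_sum -nneseriesD.
- apply: eq_eseriesr => i _; rewrite -EFinD; congr EFin.
  have -> : (x + y) i = x i + y i by [].
  by have [->|->] := xy i; rewrite ?add0r ?addr0 normr0 powR0 ?gt_eqF// ?add0r ?addr0.
- by move=> i _ _; rewrite lee_fin powR_ge0.
- by move=> i _ _; rewrite lee_fin powR_ge0.
Qed.

Definition lp_proj l x : X l := x l.

Lemma lp_proj_linear l : linear (lp_proj l). Proof. by []. Qed.
HB.instance Definition _ l :=
  GRing.isLinear.Build R Xp (X l) *:%R (lp_proj l) (lp_proj_linear l).

Lemma lp_sum_dfwith l (a : X l) :
  (lp_sum p (dfwith (fun i => 0%R : X i) l a) <= (`|a| `^ p)%:E)%E.
Proof.
apply: lp_sum_ub => n; rewrite lee_fin; have [ln|nl] := ltnP l n.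
  rewrite (bigD1 (Ordinal ln))//= dfwithin big1 ?addr0// => i il.
  by rewrite dfwithout; [rewrite normr0 powR0// gt_eqF|rewrite eq_sym].
rewrite big1 ?powR_ge0// => i _.
by rewrite dfwithout; [rewrite normr0 powR0// gt_eqF|rewrite gtn_eqF// (leq_trans _ nl)].
Qed.

Lemma lp_sum_dfwith_fin l (a : X l) :
  (lp_sum p (dfwith (fun i => 0%R : X i) l a) < +oo)%E.
Proof. exact: le_lt_trans (lp_sum_dfwith a) (ltry _). Qed.

Definition lp_single l (a : X l) : Xp := LpProduct p1 (lp_sum_dfwith_fin a).

Lemma lp_single_in l (a : X l) : lp_single a l = a.
Proof. exact: dfwithin. Qed.

Lemma lp_single_out l (a : X l) i : i != l -> lp_single a i = 0.
Proof. by rewrite eq_sym; exact: dfwithout. Qed.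

Lemma lp_single_linear l : linear (@lp_single l).
Proof.
move=> a u v; apply: lp_productP => i.
change (lp_single (a *: u + v) i = a *: lp_single u i + lp_single v i).
have [->|il] := eqVneq i l; first by rewrite !lp_single_in.
by rewrite !lp_single_out// scaler0 addr0.
Qed.
HB.instance Definition _ l :=
  GRing.isLinear.Build R (X l) Xp *:%R (@lp_single l) (@lp_single_linear l).

Lemma lp_norm_single l (a : X l) : `|lp_single a| = `|a|.
Proof.
have al : `|a| <= `|lp_single a|.
  by have := lp_coord_le_norm (lp_single a) l; rewrite lp_single_in.
apply/le_anti; rewrite al andbT; apply: (@powR_le_cancel _ p) => //.
by rewrite -lee_fin [leLHS]lp_norm_powR; exact: lp_sum_dfwith.
Qed.

Definition lp_trunc N x : Xp := \sum_(l < N) lp_single (x l).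

Lemma lp_trunc_coord N x i : lp_trunc N x i = if (i < N)%N then x i else 0.
Proof.
rewrite /lp_trunc; elim: N => [|N IH]; first by rewrite big_ord0.
rewrite big_ord_recr/=.
set y := \sum_(l < N) _ in IH *.
rewrite IH; have [->|iN] := eqVneq i N.
  by rewrite ltnn ltnSn add0r dfwithin.
rewrite dfwithout 1?eq_sym// addr0.
by rewrite [(i < N.+1)%N]ltnS [(i <= N)%N]leq_eqVlt (negPf iN).
Qed.

Lemma lp_trunc_disjoint N x i : lp_trunc N x i = 0 \/ (x - lp_trunc N x) i = 0.
Proof.
have -> : (x - lp_trunc N x) i = x i - lp_trunc N x i by [].
by rewrite lp_trunc_coord; case: ifP => _; [right; rewrite subrr|left].
Qed.

Lemma lp_norm_trunc N x :
  `|x| `^ p = `|lp_trunc N x| `^ p + `|x - lp_trunc N x| `^ p.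
Proof.
rewrite -lp_normD_disjoint; first by rewrite addrC subrK.
exact: lp_trunc_disjoint.
Qed.

Lemma lp_normB_trunc_le N x : `|x - lp_trunc N x| <= `|x|.
Proof.
apply: (powR_le_cancel p0 (normr_ge0 _) (normr_ge0 _)).
by rewrite [leRHS](lp_norm_trunc N x) lerDr; exact: powR_ge0.
Qed.

(** If every tail had norm above e, all partial sums would be at most |x|^p - e^p, and so would
    their supremum |x|^p. *)
Lemma lp_trunc_approx x (e : R) : 0 < e -> exists N, `|x - lp_trunc N x| <= e.
Proof.
move=> e0; apply: contrapT => /forallNP H.
suff : `|x| `^ p <= `|x| `^ p - e `^ p.
  by apply/negP; rewrite -ltNge ltrBlDr ltrDl powR_gt0.
apply: (@lp_norm_powR_le _ 0) => n _; rewrite [X in X - _](lp_norm_trunc n x) -addrA.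
rewrite (le_trans (y := `|lp_trunc n x| `^ p))//.
  apply: le_trans (lp_norm_powR_ge _ n); apply: ler_sum => i _.
  by rewrite lp_trunc_coord ltn_ord.
rewrite lerDl subr_ge0; apply: ge0_ler_powR; rewrite ?nnegrE ?(ltW p0) ?(ltW e0)//.
by have /negP := H n; rewrite -ltNge => /ltW.
Qed.

End lp_coordinates.

(** * Consequences of p > 1: convexity gaps and small tails of functionals *)

Section lp_strict.
Context {R : realType} {X : nat -> completeNormedModType R} {p : R}.
Variable (p_gt1 : 1 < p).
Local Notation Xp := (lp_product X (ltW p_gt1)).
Implicit Types x y : Xp.

Let p0 : 0 < p. Proof. exact: lt_trans p_gt1. Qed.

(* All coordinate gaps are nonnegative by midpoint convexity, and their sum is
   at most the right-hand side. *)
Lemma lp_coord_gap_le x y l :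
  `|x l| `^ p + `|y l| `^ p - 2 * ((`|x l| + `|y l|) / 2) `^ p <=
  `|x| `^ p + `|y| `^ p - 2 * `|2^-1 *: (x + y)| `^ p.
Proof.
pose gap i : R := `|x i| `^ p + `|y i| `^ p - 2 * ((`|x i| + `|y i|) / 2) `^ p.
have gap0 i : 0 <= gap i by rewrite subr_ge0 powR_midpoint_le.
rewrite -/(gap l).
rewrite lerBrDl -lerBrDr -ler_pdivlMl//.
apply: (@lp_norm_powR_le _ _ _ _ _ l.+1) => n ln.
have mid i : 2 * `|(2^-1 *: (x + y)) i| `^ p <= `|x i| `^ p + `|y i| `^ p - gap i.
  rewrite /gap subKr ler_pM2l//.
  have -> : (2^-1 *: (x + y)) i = 2^-1 *: (x i + y i) by [].
  apply: ge0_ler_powR; rewrite ?nnegrE ?(ltW p0)// ?divr_ge0 ?addr_ge0//.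
  by rewrite normrZ ger0_norm ?invr_ge0// mulrC ler_pM2r ?invr_gt0// ler_normD.
rewrite ler_pdivlMl// mulr_sumr.
apply: (le_trans (ler_sum _ (fun (i : 'I_n) _ => mid i))).
rewrite sumrB big_split/=; apply: lerB.
  by apply: lerD; exact: lp_norm_powR_ge.
by rewrite (bigD1 (Ordinal ln))//= lerDl sumr_ge0//.
Qed.

(* Otherwise consecutive blocks on which f is at least e / 2 have a sum of m
   blocks of norm at most m `^ (1 / p), contradicting the boundedness of f. *)
Lemma lp_functional_tail (f : {linear Xp -> R^o}) (e : R) :
  continuous (f : Xp -> R^o) -> 0 < e ->
  exists N, forall x, (forall i, (i < N)%N -> x i = 0) -> `|f x| <= e * `|x|.
Proof.
move=> /continuous_linear_norm_le[K K0 fK] e0; apply: contrapT => /forallNP H.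
have half (A B C : R) : e < A -> A - B <= C -> C <= e / 2 -> e / 2 <= B by lra.
have block N : exists x, [/\ `|x| <= 1, (forall i, (i < N)%N -> x i = 0),
    e / 2 <= f x & exists M, forall i, (M <= i)%N -> x i = 0].
  have /existsNP[x /not_implyP[xN /negP]] := H N; rewrite -ltNge => fx.
  have x0 : 0 < `|x|.
    rewrite normr_gt0; apply: contraTneq fx => ->.
    by rewrite raddf0 !normr0 mulr0 ltxx.
  pose a := (Num.sg (f x : R)) / `|x|.
  have fax : e < f (a *: x).
    rewrite linearZ/= /a /GRing.scale/= mulrAC -normrEsg ltr_pdivlMr//.
  have ax1 : `|a *: x| <= 1.
    rewrite normrZ /a normrM normfV normr_id mulfVK ?gt_eqF//.
    by rewrite normr_sg; case: (_ != _).
  (* Truncation gives the block finite support, so that the next block can start beyond it. An error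
     of e / (2K) changes f by at most e / 2. *)
  have [M xM] := lp_trunc_approx (a *: x) (divr_gt0 e0 (mulr_gt0 (ltr0Sn R 1) K0)).
  exists (lp_trunc M (a *: x)); split.
  - apply: le_trans ax1.
    apply: (powR_le_cancel p0 (normr_ge0 _) (normr_ge0 _)).
    by rewrite [leRHS](lp_norm_trunc M (a *: x)) lerDl; exact: powR_ge0.
  - move=> i iN; rewrite lp_trunc_coord; case: ifP => // _.
    by have -> : (a *: x) i = a *: x i by []; rewrite xN// scaler0.
  - have := fK (a *: x - lp_trunc M (a *: x)).
    rewrite linearB/= => /ler_normlP[_ fB].
    have : K * `|a *: x - lp_trunc M (a *: x)| <= e / 2.
      have -> : e / 2 = K * (e / (2 * K)) by field; rewrite gt_eqF.
      by rewrite ler_pM2l.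
    exact: half fax fB.
  - by exists M => i Mi; rewrite lp_trunc_coord ltnNge Mi.
have blocks m : exists y, [/\ `|y| `^ p <= m%:R, m%:R * (e / 2) <= f y &
    exists N, forall i, (N <= i)%N -> y i = 0].
  elim: m => [|m [y [ym fy [N yN]]]].
    exists 0; split; rewrite ?normr0 ?powR0 ?gt_eqF// ?raddf0 ?mul0r//.
    by exists 0.
  have [x [x1 xN fx [M xM]]] := block N.
  exists (y + x); split.
  - rewrite lp_normD_disjoint -?natr1; last first.
      by move=> i; case: (ltnP i N) => [/xN|/yN]; [right|left].
    apply: lerD => //; have : `|x| `^ p <= 1 `^ p.
      by apply: ge0_ler_powR; rewrite ?nnegrE ?(ltW p0).
    by rewrite [X in _ <= X -> _](_ : _ = 1)// powR1.
  - by rewrite raddfD/= -natr1 mulrDl mul1r lerD.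
  - exists (maxn N M) => i; rewrite geq_max => /andP[Ni Mi].
    by have -> : (y + x) i = y i + x i by []; rewrite yN// xM// addr0.
(* From m e/2 <= f y <= K |y| and |y|^p <= m follows m^(p-1) <= C, which fails for large m because p
   > 1. *)
pose C := (K / (e / 2)) `^ p.
have [m m0 mC] : exists2 m : nat, (0 < m)%N & C < m%:R `^ (p - 1).
  have p10 : 0 < p - 1 by rewrite subr_gt0.
  exists (Num.trunc (C `^ (p - 1)^-1)).+1 => //.
  have CE : (C `^ (p - 1)^-1) `^ (p - 1) = C.
    by rewrite -powRrM mulVf ?gt_eqF// powRr1// powR_ge0.
  rewrite -[ltLHS]CE; apply: gt0_ltr_powR; rewrite ?nnegrE ?powR_ge0//.
  exact: truncnS_gt.
have [y [ym fy _]] := blocks m.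
suff : m%:R `^ (p - 1) <= C by apply/negP; rewrite -ltNge.
have m0' : 0 < m%:R :> R by rewrite ltr0n.
have e20 : 0 < e / 2 by rewrite divr_gt0.
have h1 : m%:R / (K / (e / 2)) <= `|y|.
  rewrite ler_pdivrMr ?divr_gt0// mulrA ler_pdivlMr// mulrC.
  rewrite [leLHS]mulrC (le_trans fy)// (le_trans (ler_norm _))// (le_trans (fK y))//.
  by rewrite mulrC.
have h2 : (m%:R / (K / (e / 2))) `^ p <= m%:R.
  apply: le_trans ym; apply: ge0_ler_powR; rewrite ?nnegrE ?(ltW p0)//.
  by rewrite !divr_ge0// ?(ltW K0)// ltW.
have q0 : 0 < K / (e / 2) by rewrite divr_gt0.
have : m%:R `^ p <= m%:R * C.
  have -> : m%:R `^ p = (m%:R / (K / (e / 2))) `^ p * C.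
    rewrite /C -powRM ?divfK ?gt_eqF//; first by rewrite divr_ge0// ltW.
    exact: ltW.
  by rewrite ler_wpM2r// powR_ge0.
have -> : m%:R `^ p = m%:R * m%:R `^ (p - 1) :> R.
  rewrite -{2}[m%:R]powRr1 ?ler0n// -powRD; last by rewrite (gt_eqF m0') implybT.
  by rewrite addrC subrK.
by rewrite ler_pM2l.
Qed.

End lp_strict.

(** * Flat rank of an l_p-product *)

Section lp_flat.
Context {R : realType} (U : set_system nat) {UU : UltraFilter U}.
Context {X : nat -> completeNormedModType R} {p : R}.
Variable (p_gt1 : 1 < p).
Local Notation Xp := (lp_product X (ltW p_gt1)).

Let p0 : 0 < p. Proof. exact: lt_trans p_gt1. Qed.

Lemma bounded_seq_coord (z : nat -> Xp) l :
  bounded_seq z -> bounded_seq (fun n => z n l).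
Proof.
by move=> [M zM]; exists M => n; apply: le_trans (lp_coord_le_norm _ _) (zM n).
Qed.

Lemma cvg_powR (u : nat -> R) a : (forall n, 0 <= u n) ->
  u n @[n --> U] --> a -> u n `^ p @[n --> U] --> a `^ p.
Proof.
move=> u0 ua; apply: (cvg_powR_ge0 (ltW p_gt1)) => //.
by apply: (cvgr_to_ge ua); near=> n.
Unshelve. all: by end_near. Qed.

(* The norms of z, y = z + sum t v and (z + y) / 2 have the same limit, which
   closes the convexity gap of every coordinate. *)
Lemma flat_family_coord s (I : finType) (z : nat -> Xp) (v : I -> nat -> Xp) l :
  bounded_seq z -> (forall i, bounded_seq (v i)) -> flat_family U s z v ->
  flat_family U s (fun n => z n l) (fun i n => v i n l).
Proof.
move=> zb vb vP t tP.
pose y n : Xp := z n + \sum_i t i *: v i n.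
have yl n : z n l + \sum_i t i *: v i n l = y n l.
  rewrite -/(lp_proj l (y n)) /y linearD/= linear_sum/=.
  by congr (_ + _); apply: eq_bigr => i _; rewrite linearZ.
rewrite [X in X @ _](_ : _ = fun n => `|y n l| - `|z n l|); last first.
  by apply/funext => n; rewrite yl.
have yb : bounded_seq y := bounded_seq_lincomb t zb vb.
have yC : `|y n| @[n --> U] --> ulim U (fun n => `|z n|).
  exact: flat_family_cvg zb vP tP.
have mC : `|2^-1 *: (z n + y n)| @[n --> U] --> ulim U (fun n => `|z n|).
  (* The midpoint of z and y is z + sum (t/2) v, again an admissible point of the flat family. *)
  have tP2 : coefs s (fun i => 2^-1 * t i).
    have [t0 t1] := tP; split => [i|].
      by have := t0 i; case: s {vP tP t0} => //= ti; rewrite mulr_ge0// invr_ge0.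
    under eq_bigr do rewrite normrM; rewrite -mulr_sumr ger0_norm ?invr_ge0//.
    by rewrite mulrC ler_pdivrMr// mul1r (le_trans t1)// ler1n.
  rewrite [X in X @ _](_ : _ = fun n => `|z n + \sum_i (2^-1 * t i) *: v i n|).
    exact: flat_family_cvg zb vP tP2.
  have half2 : 2^-1 + 2^-1 = 1 :> R by field.
  apply/funext => n; congr `|_|.
  rewrite /y !scalerDr addrA -scalerDl half2 scale1r scaler_sumr; congr (_ + _).
  by apply: eq_bigr => i _; rewrite scalerA.
have zC := cvg_ulim (UU := UU) (bounded_seq_norm zb).
set C := ulim U _ in yC mC zC.
have za := cvg_ulim (UU := UU) (bounded_seq_norm (bounded_seq_coord l zb)).
have ya := cvg_ulim (UU := UU) (bounded_seq_norm (bounded_seq_coord l yb)).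
set a := ulim U _ in za; set b := ulim U _ in ya.
have a0 : 0 <= a by apply: (cvgr_to_ge za); near=> n.
have b0 : 0 <= b by apply: (cvgr_to_ge ya); near=> n.
suff ab : a = b.
  rewrite ab in za; rewrite -[X in _ --> X](subrr b); exact: cvgB ya za.
apply/eqP; apply/negPn/negP => ab.
have := powR_midpoint_lt p_gt1 a0 b0 ab; apply/negP; rewrite -leNgt -subr_le0.
have cvg1 : `|z n l| `^ p + `|y n l| `^ p - 2 * ((`|z n l| + `|y n l|) / 2) `^ p
    @[n --> U] --> a `^ p + b `^ p - 2 * ((a + b) / 2) `^ p.
  apply: cvgB; first by apply: cvgD; apply: cvg_powR.
  apply: cvgM; first exact: cvg_cst.
  apply: cvg_powR; first by move=> n; rewrite divr_ge0// addr_ge0.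
  by apply: cvgM; [exact: cvgD|exact: cvg_cst].
have cvg2 : `|z n| `^ p + `|y n| `^ p - 2 * `|2^-1 *: (z n + y n)| `^ p
    @[n --> U] --> C `^ p + C `^ p - 2 * C `^ p.
  exact: (cvgB (cvgD (cvg_powR (fun n => normr_ge0 _) zC)
    (cvg_powR (fun n => normr_ge0 _) yC))
    (cvgM (cvg_cst _) (cvg_powR (fun n => normr_ge0 _) mC))).
have -> : 0 = C `^ p + C `^ p - 2 * C `^ p by ring.
apply: (ler_cvg_to cvg1 cvg2); near=> n; exact: lp_coord_gap_le.
Unshelve. all: by end_near. Qed.

(** * Upper bound: the limit matrix as a sum over coordinates *)

Definition lp_restrict (f : {linear Xp -> R^o}) l : {linear X l -> R^o} :=
  f \o @lp_single _ _ _ (ltW p_gt1) l.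

Lemma lp_restrict_continuous (f : {linear Xp -> R^o}) l :
  continuous (f : Xp -> R^o) -> continuous (lp_restrict f l : X l -> R^o).
Proof.
move=> /continuous_linear_norm_le[K K0 fK].
apply: (@linear_norm_le_continuous _ _ _ K) => x.
by rewrite -(lp_norm_single (ltW p_gt1) x); exact: fK.
Qed.

Definition lp_extend l (f : {linear X l -> R^o}) : {linear Xp -> R^o} :=
  f \o lp_proj (p1 := ltW p_gt1) l.

Lemma lp_extend_continuous l (f : {linear X l -> R^o}) :
  continuous (f : X l -> R^o) -> continuous (lp_extend f : Xp -> R^o).
Proof.
move=> /continuous_linear_norm_le[K K0 fK].
apply: (@linear_norm_le_continuous _ _ _ K) => x.
apply: le_trans (fK _) _; rewrite ler_pM2l//; exact: lp_coord_le_norm.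
Qed.

(** The uniformly small tails of f allow the ultralimit to pass through the infinite sum: mass of v
    escaping to ever higher coordinates contributes nothing in the limit. *)
Lemma ulim_lp_functional (f : {linear Xp -> R^o}) (v : nat -> Xp) j :
  continuous (f : Xp -> R^o) -> bounded_seq v ->
  (forall l, (j <= l)%N -> ulim U (fun n => lp_restrict f l (v n l)) = 0) ->
  ulim U (fun n => f (v n)) =
  \sum_(l < j) ulim U (fun n => lp_restrict f l (v n l)).
Proof.
move=> fc [B vB] f0.
apply/eqP; rewrite -subr_eq0 -normr_le0; apply/ler_addgt0Pr => e e0; rewrite add0r.
have B1 : 0 < B + 1 by rewrite ltr_wpDl// (le_trans _ (vB 0%N)).
have [N0 fN] := lp_functional_tail fc (divr_gt0 e0 B1).
(* Beyond [N0] the tail of f is at most e on the sequence; taking at least [j] terms only adds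
   limits that vanish. *)
pose N := maxn N0 j.
have -> : \sum_(l < j) ulim U (fun n => lp_restrict f l (v n l)) =
          \sum_(l < N) ulim U (fun n => lp_restrict f l (v n l)).
  rewrite -!(big_mkord xpredT (fun l => ulim U (fun n => lp_restrict f l (v n l)))).
  rewrite [RHS](big_cat_nat (leq0n j) (leq_maxr N0 j))/=.
  rewrite [X in _ = _ + X]big_nat_cond [X in _ = _ + X]big1 ?addr0// => l.
  by rewrite andbT => /andP[/f0].
have cf : (f (v n) : R) @[n --> U] --> ulim U (fun n => f (v n)).
  by apply: cvg_ulim; apply: bounded_seq_linear => //; exists B.
have cs : \sum_(l < N) (lp_restrict f l (v n l) : R) @[n --> U] -->
    \sum_(l < N) ulim U (fun n => lp_restrict f l (v n l)).
  apply: cvg_big => [|l _]; first exact: add_continuous.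
  apply: cvg_ulim; apply: bounded_seq_linear; first exact: lp_restrict_continuous.
  by apply: bounded_seq_coord; exists B.
apply: (cvgr_to_le (cvg_norm (cvgB cf cs))); near=> n.
have fE : f (v n - lp_trunc N (v n)) =
    f (v n) - \sum_(l < N) lp_restrict f l (v n l).
  by rewrite linearB/= /lp_trunc linear_sum.
change (`|(f (v n) - \sum_(l < N) lp_restrict f l (v n l) : R)| <= e).
rewrite -fE.
apply: le_trans (fN _ _) _ => [i iN|].
  have -> : (v n - lp_trunc N (v n)) i = v n i - lp_trunc N (v n) i by [].
  by rewrite lp_trunc_coord (leq_trans iN (leq_maxl _ _)) subrr.
rewrite mulrAC ler_pdivrMr// ler_pM2l//.
apply: le_trans (lp_normB_trunc_le _ _) _; apply: le_trans (vB n) _.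
by rewrite lerDl.
Unshelve. all: by end_near. Qed.

(** The coordinates from j on have zero limit matrices, and the others have rank at most kk_l - 1,
    so subadditivity bounds the rank of the whole matrix by k - 1. *)
Lemma lp_flat_rank_lt s (c : bool) k j (kk : 'I_j -> nat) :
  (forall l, (j <= l)%N -> ~ flat_rank_ge U s c 1 (X l)) ->
  (forall i, (0 < kk i)%N) -> ((\sum_(i < j) kk i) - j + 1 <= k)%N ->
  (forall i : 'I_j, ~ flat_rank_ge U s c (kk i) (X i)) ->
  ~ flat_rank_ge U s c k Xp.
Proof.
move=> X1 kk0 kkk Xk [z [v [f [[zb zc] vb vP fc]]]].
apply/negP/negPn; set M := ulim_mx U v f.
pose G l := ulim_mx U (fun i n => v i n l) (fun q => lp_restrict (f q) l).
have rG l r : ~ flat_rank_ge U s c r (X l) -> (\rank (G l) < r)%N.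
  move=> Xr; rewrite ltnNge; apply/negP => rG; apply: Xr.
  have zcl : c -> forall n, z n l = z 0%N l by move=> /zc zn n; rewrite [in LHS]zn.
  apply: (@flat_rank_ge_mx R U s c r (X l) k k (fun n => z n l)
    (fun i n => v i n l) (fun q => lp_restrict (f q) l)) => //.
  - exact: (bounded_seq_coord l zb).
  - by move=> i; exact: (bounded_seq_coord l (vb i)).
  - exact: (flat_family_coord l zb vb vP).
  - by move=> q; apply: lp_restrict_continuous; exact: fc.
have MG : M = \sum_(l < j) G l.
  apply/matrixP => q i; rewrite !mxE summxE.
  have G0 l : (j <= l)%N -> ulim U (fun n => lp_restrict (f q) l (v i n l)) = 0.
    move=> /X1/rG; rewrite ltnS leqn0 mxrank_eq0 => /eqP/matrixP/(_ q i).
    by rewrite !mxE.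
  rewrite (ulim_lp_functional (fc q) (vb i) G0).
  by apply: eq_bigr => l _; rewrite mxE.
have rM : (\rank M <= \sum_(l < j) (kk l).-1)%N.
  rewrite MG; elim/big_ind2 : _ => [||l _]; first by rewrite mxrank0.
    by move=> A a B b Aa Bb; rewrite (leq_trans (mxrank_add _ _))// leq_add.
  by rewrite -ltnS prednK//; exact: rG.
suff : (\rank M < k)%N.
  apply: contraTT => M0; rewrite -leqNgt.
  have : M \in unitmx by rewrite unitmxE unitfE.
  by rewrite -row_free_unit => /eqP ->.
apply: leq_trans kkk; rewrite addn1 ltnS (leq_trans rM)//.
(* The natural-number subtraction is exact because each [kk l] is at least 1. *)
rewrite leq_subRL; last first.
  rewrite -[X in (X <= _)%N](card_ord j) -sum1_card; exact: leq_sum.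
rewrite -[X in (X + _ <= _)%N](card_ord j) -sum1_card -big_split/=.
by apply: leq_sum => i _; rewrite add1n prednK.
Qed.

(** * Lower bound: combining flat families of distinct coordinates *)

Lemma ulim_normD_disjoint (x y : nat -> Xp) a b :
  bounded_seq x -> bounded_seq y -> (forall n i, x n i = 0 \/ y n i = 0) ->
  `|x n| @[n --> U] --> a -> `|y n| @[n --> U] --> b ->
  ulim U (fun n => `|x n + y n|) `^ p = a `^ p + b `^ p.
Proof.
move=> xb yb xy xa yb'.
have xyC := cvg_ulim (UU := UU) (bounded_seq_norm (bounded_seqD xb yb)).
have h1 := cvg_powR (fun n => normr_ge0 (x n + y n)) xyC.
have h2 : `|x n + y n| `^ p @[n --> U] --> a `^ p + b `^ p.
  under eq_cvg do rewrite (lp_normD_disjoint (xy _)).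
  exact: cvgD (cvg_powR (fun n => normr_ge0 (x n)) xa)
              (cvg_powR (fun n => normr_ge0 (y n)) yb').
exact: (cvg_unique _ h1 h2).
Qed.

(** The induction invariant: everything vanishes from coordinate N on, which leaves that coordinate
    free for the next family. *)
Definition flat_rank_ge_below (s c : bool) r N :=
  exists (z : nat -> Xp) (v : 'I_r -> nat -> Xp) (f : 'I_r -> {linear Xp -> R^o}),
    [/\ bounded_seq z /\ (c -> forall n, z n = z 0%N),
        (forall i, bounded_seq (v i)) /\ flat_family U s z v,
        forall j, continuous (f j : Xp -> R^o), \det (ulim_mx U v f) != 0 &
        forall l n, (N <= l)%N -> z n l = 0 /\ forall i, v i n l = 0].

(** Each half of an admissible coefficient vector is admissible, and p-th powers of norms add on
    disjoint supports, so the limit norm of the sum depends only on those of the two flat parts. *)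
Lemma flat_rank_ge_belowS (s c : bool) r q N :
  flat_rank_ge_below s c r N -> flat_rank_ge U s c q (X N) ->
  flat_rank_ge_below s c (r + q) N.+1.
Proof.
move=> [z [v [f [[zb zc] [vb vP] fc df zvN]]]].
move=> [y [w [g [[yb yc] wb wP gc dg]]]].
pose sg := @lp_single R X p (ltW p_gt1) N.
have sgb (x : nat -> X N) : bounded_seq x -> bounded_seq (fun n => sg (x n)).
  by move=> [M xM]; exists M => n; rewrite lp_norm_single.
pose v' i n := match fintype.split i with inl i1 => v i1 n | inr i2 => sg (w i2 n) end.
pose f' i := match fintype.split i with inl i1 => f i1 | inr i2 => lp_extend (g i2) end.
have v'l i n : v' (lshift q i) n = v i n.
  by rewrite /v' (unsplitK (inl i : 'I_r + 'I_q)).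
have v'r i n : v' (rshift r i) n = sg (w i n).
  by rewrite /v' (unsplitK (inr i : 'I_r + 'I_q)).
have f'l i : f' (lshift q i) = f i.
  by rewrite /f' (unsplitK (inl i : 'I_r + 'I_q)).
have f'r i : f' (rshift r i) = lp_extend (g i).
  by rewrite /f' (unsplitK (inr i : 'I_r + 'I_q)).
exists (fun n => z n + sg (y n)), v', f'; split.
- split; first exact: bounded_seqD (sgb _ yb).
  by move=> c1 n; rewrite zc// yc.
- split.
    move=> i; rewrite /v'; case: (fintype.split i) => a; first exact: vb.
    exact/sgb/wb.
  move=> t [t0 t1].
  pose tl i := t (lshift q i); pose tr i := t (rshift r i).
  have t1' : \sum_i `|tl i| + \sum_i `|tr i| <= 1.
    by apply: le_trans t1; rewrite big_split_ord.
  have tlP : coefs s tl.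
    split; first by move=> i; exact: t0.
    by apply: le_trans t1'; rewrite lerDl sumr_ge0.
  have trP : coefs s tr.
    split; first by move=> i; exact: t0.
    by apply: le_trans t1'; rewrite lerDr sumr_ge0.
  pose a n := z n + \sum_i tl i *: v i n.
  pose b n := y n + \sum_i tr i *: w i n.
  have abE n : z n + sg (y n) + \sum_i t i *: v' i n = a n + sg (b n).
    rewrite big_split_ord/= /a /b.
    under eq_bigr do rewrite v'l.
    under [X in _ + _ + (_ + X)]eq_bigr do rewrite v'r.
    rewrite addrACA; congr (_ + _).
    rewrite /sg linearD/= linear_sum/=; congr (_ + _).
    by apply: eq_bigr => i _; rewrite linearZ.
  rewrite [X in X @ _](_ : _ = fun n =>
      `|a n + sg (b n)| - `|z n + sg (y n)|); last first.
    by apply/funext => n; rewrite abE.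
  have ab : bounded_seq a := bounded_seq_lincomb tl zb vb.
  have bb : bounded_seq b := bounded_seq_lincomb tr yb wb.
  have aN n : a n N = 0.
    rewrite -/(lp_proj N (a n)) /a linearD/= linear_sum/=.
    have [zN vN] := zvN N n (leqnn N).
    rewrite {1}/lp_proj zN add0r big1// => i _.
    by rewrite /lp_proj vN scaler0.
  have disj (x1 : Xp) (x2 : X N) : x1 N = 0 -> forall i, x1 i = 0 \/ sg x2 i = 0.
    move=> x10 i; have [->|iN] := eqVneq i N; [by left|right].
    exact: lp_single_out.
  have aC := flat_family_cvg (UU := UU) zb vP tlP.
  have bC : `|sg (b n)| @[n --> U] --> ulim U (fun n => `|y n|).
    rewrite [X in X @ _](_ : _ = fun n => `|b n|); last first.
      by apply/funext => n; exact: lp_norm_single.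
    exact: flat_family_cvg yb wP trP.
  have zC := cvg_ulim (UU := UU) (bounded_seq_norm zb).
  have yC : `|sg (y n)| @[n --> U] --> ulim U (fun n => `|y n|).
    rewrite [X in X @ _](_ : _ = fun n => `|y n|); last first.
      by apply/funext => n; exact: lp_norm_single.
    exact: (cvg_ulim (bounded_seq_norm yb)).
  have E1 := ulim_normD_disjoint ab (sgb _ bb) (fun n => disj _ _ (aN n)) aC bC.
  have zN n : z n N = 0 by have [] := zvN N n (leqnn N).
  have E2 := ulim_normD_disjoint zb (sgb _ yb) (fun n => disj _ _ (zN n)) zC yC.
  have C1 := cvg_ulim (UU := UU) (bounded_seq_norm (bounded_seqD ab (sgb _ bb))).
  have C2 := cvg_ulim (UU := UU) (bounded_seq_norm (bounded_seqD zb (sgb _ yb))).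
  have C1ge : 0 <= ulim U (fun n => `|a n + sg (b n)|).
    by apply: (cvgr_to_ge C1); near=> n.
  have C2ge : 0 <= ulim U (fun n => `|z n + sg (y n)|).
    by apply: (cvgr_to_ge C2); near=> n.
  have E := powR_cancel p0 C1ge C2ge (etrans E1 (esym E2)).
  rewrite E in C1.
  rewrite -[X in _ --> X](subrr (ulim U (fun n => `|z n + sg (y n)|))).
  exact: cvgB C1 C2.
- move=> i; rewrite /f'; case: (fintype.split i) => a; first exact: fc.
  exact: lp_extend_continuous.
(* The new functionals see only coordinate N, where the old directions vanish. The old functionals
   may act on the new directions, so the matrix is only block triangular. *)
- have -> : ulim_mx U v' f' = block_mx (ulim_mx U v f)
      (\matrix_(i, j) ulim U (fun n => f i (sg (w j n)))) 0 (ulim_mx U w g).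
    apply/matrixP => i j; rewrite !mxE.
    case: (split_ordP i) => i' ->; case: (split_ordP j) => j' ->;
      rewrite ?(unsplitK (inl _)) ?(unsplitK (inr _)) !mxE.
    + rewrite ?(unsplitK (inl _ : 'I_r + 'I_q)) !mxE f'l; congr ulim.
      by apply/funext => n; rewrite v'l.
    + rewrite ?(unsplitK (inr _ : 'I_r + 'I_q)) !mxE f'l; congr ulim.
      by apply/funext => n; rewrite v'r.
    + rewrite ?(unsplitK (inl _ : 'I_r + 'I_q)) !mxE f'r.
      apply: ulimP; rewrite [X in X @ _](_ : _ = fun=> 0); first exact: cvg_cst.
      apply/funext => n; rewrite v'l /lp_extend/= /lp_proj.
      by have [_ ->] := zvN N n (leqnn N); rewrite linear0.
    + rewrite ?(unsplitK (inr _ : 'I_r + 'I_q)) !mxE f'r; congr ulim; apply/funext => n.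
      by rewrite v'r; exact: (congr1 (g i') (lp_single_in _ _)).
  by rewrite det_ublock mulf_neq0.
- move=> l n Nl; have [zl vl] := zvN l n (ltnW Nl).
  have sl x : sg x l = 0 by apply: lp_single_out; rewrite gtn_eqF.
  split; first by rewrite -[LHS]/(z n l + sg (y n) l) zl sl addr0.
  by move=> i; rewrite /v'; case: (fintype.split i) => a; [exact: vl|exact: sl].
Unshelve. all: by end_near. Qed.

Lemma flat_rank_ge_below_sum (s c : bool) (r : nat -> nat) N :
  (forall l, flat_rank_ge U s c (r l) (X l)) ->
  flat_rank_ge_below s c (\sum_(l < N) r l) N.
Proof.
move=> Xr; elim: N => [|N IH]; last first.
  by rewrite big_ord_recr/=; exact: flat_rank_ge_belowS.
rewrite big_ord0.
exists (fun=> 0), (fun=> fun=> 0), (fun=> \0); split => //.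
- by split => //; exact: bounded_seq_cst.
- split => [[]//|] t _.
  by under eq_cvg do rewrite big_ord0 addr0 subrr; exact: cvg_cst.
- by case.
- by rewrite det_mx00 oner_eq0.
Qed.

Lemma lp_flat_rank_ge_sum (s c : bool) (r : nat -> nat) N k :
  (forall l, flat_rank_ge U s c (r l) (X l)) ->
  (k <= \sum_(l < N) r l)%N -> flat_rank_ge U s c k Xp.
Proof.
move=> /(@flat_rank_ge_below_sum s c r N).
move=> [z [v [f [[zb zc] [vb vP] fc df _]]]] kr.
apply: (flat_rank_ge_mx zb zc vb vP fc).
apply: leq_trans kr _; rewrite leq_eqVlt eq_sym; apply/orP; left.
by rewrite -/(row_free _) row_free_unit unitmxE unitfE.
Qed.

(** Every finite sum of coordinate ranks is a flat rank of the product, hence below k. Integrality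
    then forces all but finitely many of these ranks to be 0, and rank + 1 is the least possible
    k_i. *)
Theorem lp_flat_rankP (s c : bool) k : (0 < k)%N ->
  ~ flat_rank_ge U s c k Xp <->
  exists j : nat, [/\ (0 < j)%N,
    (forall i, (j <= i)%N -> ~ flat_rank_ge U s c 1 (X i)) &
    exists kk : 'I_j -> nat,
      [/\ (forall i, (0 < kk i)%N), ((\sum_(i < j) kk i) - j + 1 <= k)%N &
          (forall i : 'I_j, ~ flat_rank_ge U s c (kk i) (X i))]].
Proof.
move=> k0; split; last first.
  by move=> [j [_ X1 [kk [kk0 kkk Xk]]]]; exact: lp_flat_rank_lt kkk Xk.
move=> Xk.
have /choice[r rP] l : exists r, flat_rank_ge U s c r (X l) /\
    forall r', flat_rank_ge U s c r' (X l) -> (r' <= r)%N.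
  have ex : exists r, `[< flat_rank_ge U s c r (X l) >].
    by exists 0%N; apply/asboolP; exact: flat_rank_ge0.
  have ub r : `[< flat_rank_ge U s c r (X l) >] -> (r <= k)%N.
    move=> /asboolP Xr; rewrite leqNgt; apply/negP => kr; apply: Xk.
    pose rr i := if i == l then r else 0%N.
    apply: (@lp_flat_rank_ge_sum s c rr l.+1).
      by move=> i; rewrite /rr; case: eqP => [->//|_]; exact: flat_rank_ge0.
    by rewrite big_ord_recr/= {2}/rr eqxx (leq_trans (ltnW kr))// leq_addl.
  have [r /asboolP Xr rmax] := ex_maxnP ex ub.
  by exists r; split => // r' Xr'; apply: rmax; exact/asboolP.
have sum_lt N : (\sum_(l < N) r l < k)%N.
  rewrite ltnNge; apply/negP => kN; apply: Xk.
  by apply: lp_flat_rank_ge_sum kN => l; have [] := rP l.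
(* The partial sums are bounded integers, so one of them is maximal; beyond it every rank is 0. *)
have [N Nmax] : exists N, forall N', (\sum_(l < N') r l <= \sum_(l < N) r l)%N.
  have ex1 : exists m, `[< exists N, m = \sum_(l < N) r l >]%N.
    by exists (\sum_(l < 0) r l)%N; apply/asboolP; exists 0%N.
  have ub1 m : `[< exists N, m = \sum_(l < N) r l >]%N -> (m <= k)%N.
    by move=> /asboolP[N ->]; exact/ltnW/sum_lt.
  have [m /asboolP[N ->] mmax] := ex_maxnP ex1 ub1.
  by exists N => N'; apply: mmax; apply/asboolP; exists N'.
have r0 l : (N <= l)%N -> r l = 0%N.
  move=> Nl; apply/eqP; rewrite -leqn0 -(leq_add2l (\sum_(i < l) r i)) addn0.
  have := Nmax l.+1; rewrite big_ord_recr/= => /leq_trans; apply.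
  rewrite -!(big_mkord xpredT r) (big_cat_nat (leq0n N) Nl)/=.
  exact: leq_addr.
(* [N] may be 0, but j must be positive. The extra coordinate has rank 0, so its k_i is 1 and the
   bound is unchanged. *)
exists N.+1; split => //.
  move=> i /ltnW/r0 ri Xi; have [_ /(_ 1%N Xi)] := rP i.
  by rewrite ri.
exists (fun i => (r i).+1); split => //.
- under eq_bigr do rewrite -addn1.
  by rewrite big_split/= sum1_card card_ord addnK addn1; exact: sum_lt.
- by move=> i Xi; have [_ /(_ _ Xi)] := rP i; rewrite ltnn.
Qed.

End lp_flat.

Theorem theorem4p14 (R : realType) (X : nat -> completeNormedModType R)
    (k : nat) (p : R) (k_gt0 : (0 < k)%N) (p_gt1 : 1 < p) :
  [/\ kWUR k (lp_product X (ltW p_gt1)) <->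
        exists j : nat, [/\ (0 < j)%N,
          (forall i, (j <= i)%N -> WUR (X i)) &
          exists kk : 'I_j -> nat,
            [/\ (forall i, (0 < kk i)%N),
                ((\sum_(i < j) kk i) - j + 1 <= k)%N &
                (forall i : 'I_j, kWUR (kk i) (X i))]],
      kWLUR k (lp_product X (ltW p_gt1)) <->
        exists j : nat, [/\ (0 < j)%N,
          (forall i, (j <= i)%N -> WLUR (X i)) &
          exists kk : 'I_j -> nat,
            [/\ (forall i, (0 < kk i)%N),
                ((\sum_(i < j) kk i) - j + 1 <= k)%N &
                (forall i : 'I_j, kWLUR (kk i) (X i))]] &
      kWMLUR k (lp_product X (ltW p_gt1)) <->
        exists j : nat, [/\ (0 < j)%N,
          (forall i, (j <= i)%N -> WMLUR (X i)) &
          exists kk : 'I_j -> nat,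
            [/\ (forall i, (0 < kk i)%N),
                ((\sum_(i < j) kk i) - j + 1 <= k)%N &
                (forall i : 'I_j, kWMLUR (kk i) (X i))]]].
Proof.
(* [U] refines the filter at infinity, so errors such as 1/(n+1) vanish along it. *)
have [U [UU U_oo]] := ultraFilterLemma (F := \oo) _.
have WUR1 i := kWUR_flat_rank U_oo (X i) (ltn0Sn 0).
have WLUR1 i := kWLUR_flat_rank U_oo (X i) (ltn0Sn 0).
have WMLUR1 i := kWMLUR_flat_rank U_oo (X i) (ltn0Sn 0).
split.
- rewrite (kWUR_flat_rank U_oo _ k_gt0) (lp_flat_rankP _ _ _ k_gt0).
  split => -[j [j0 H [kk [kk0 kkk Hk]]]]; exists j; split => //.
  + by move=> i /H; rewrite -WUR1.
  + by exists kk; split => // i; rewrite kWUR_flat_rank.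
  + by move=> i /H; rewrite -WUR1.
  + by exists kk; split => // i; rewrite -kWUR_flat_rank.
- rewrite (kWLUR_flat_rank U_oo _ k_gt0) (lp_flat_rankP _ _ _ k_gt0).
  split => -[j [j0 H [kk [kk0 kkk Hk]]]]; exists j; split => //.
  + by move=> i /H; rewrite -WLUR1.
  + by exists kk; split => // i; rewrite kWLUR_flat_rank.
  + by move=> i /H; rewrite -WLUR1.
  + by exists kk; split => // i; rewrite -kWLUR_flat_rank.
- rewrite (kWMLUR_flat_rank U_oo _ k_gt0) (lp_flat_rankP _ _ _ k_gt0).
  split => -[j [j0 H [kk [kk0 kkk Hk]]]]; exists j; split => //.
  + by move=> i /H; rewrite -WMLUR1.
  + by exists kk; split => // i; rewrite kWMLUR_flat_rank.
  + by move=> i /H; rewrite -WMLUR1.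
  + by exists kk; split => // i; rewrite -kWMLUR_flat_rank.
Qed.
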